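(* Let $\{U_\epsilon\}_{\epsilon\in(0,1]}$, $U_\epsilon=SC_\epsilon$, be a family of quantum walks satisfying the conditions (i), (ii), (iii) of the context, and let $\theta\in\mathcal{O}^-_0$. Then there exists $\epsilon_0>0$ such that for any $\epsilon\in(0,\epsilon_0]$ the operator $U_\epsilon(\theta)=T(\theta)U_\epsilon T(\theta)^{-1}$ has $4(m_0+n_0)$ eigenvalues (counted with multiplicity), as does $U_{el}$. Moreover, there exists $r>0$ such that for each $k=0,1,\ldots,2(m_0+n_0)-1$ there exist $\kappa^+_{k,\epsilon},\kappa^-_{k,\epsilon}\in\mathbf{T}_{\mathbf{C}}$ such that $e^{-i\kappa^{\pm}_{k,\epsilon}}\in\sigma_p(U_\epsilon(\theta))$ and $$\left|\kappa^{\pm}_{k,\epsilon}-\frac{\pi k}{m_0+n_0}\right|<r\epsilon\quad\text{in }\mathbf{T}_{\mathbf{C}}$$ for any $\epsilon\in(0,\epsilon_0]$.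
   Context: Notation. $\mathcal{H}=\ell^2(\mathbf{Z}^2;\mathbf{C}^4)$; the components of $u(x)\in\mathbf{C}^4$ are indexed by the chiralities: $u(x)=[u_\leftarrow(x),u_\rightarrow(x),u_\downarrow(x),u_\uparrow(x)]^{\mathsf T}$, and $\mathbf{e}_\leftarrow,\mathbf{e}_\rightarrow,\mathbf{e}_\downarrow,\mathbf{e}_\uparrow$ is the standard basis of $\mathbf{C}^4$ in this order. $e_1=[1,0]^{\mathsf T}$, $e_2=[0,1]^{\mathsf T}$. $\mathbf{T}_{\mathbf{C}}=\mathbf{C}/2\pi\mathbf{Z}$, and $\mathcal{O}^-_0=\{\kappa\in\mathbf{T}_{\mathbf{C}} : \mathrm{Im}\,\kappa<0\}$. $\sigma_p(A)$ denotes the set of eigenvalues of $A$. The shift is $(Su)(x)=[u_\leftarrow(x+e_1),u_\rightarrow(x-e_1),u_\downarrow(x+e_2),u_\uparrow(x-e_2)]^{\mathsf T}$. A quantum walk is $U=SC$ on $\mathcal{H}$, where $C$ is multiplication by $C(x)\in\mathrm{U}(4)$; here always $C(x)=I_4$ outside a finite set, so that $V=U-S$ has finite rank. Complex translation: for $\theta\in\mathbf{T}_{\mathbf{C}}$, $T(\theta)$ is multiplication by $\mathrm{diag}[e^{i\theta x_1},e^{-i\theta x_1},e^{i\theta x_2},e^{-i\theta x_2}]$ on $\mathbf{C}^4$-valued sequences. For $\theta\in\mathcal{O}^-_0$, $U(\theta)=T(\theta)UT(\theta)^{-1}$ means the bounded operator $e^{-i\theta}S+T(\theta)VT(\theta)^{-1}$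 on $\mathcal{H}$ (note $T(\theta)ST(\theta)^{-1}=e^{-i\theta}S$). The model. Fix positive integers $m_0,n_0$. Let $U_{el}=SC_{el}$, where $C_{el}(x)=I_4$ for $x\notin\{(0,0),(m_0,0),(m_0,n_0),(0,n_0)\}$, and (matrices given by their columns) $C_{el}(0,0)=[\mathbf{e}_\uparrow,\mathbf{e}_\leftarrow,\mathbf{e}_\rightarrow,\mathbf{e}_\downarrow]$, $C_{el}(m_0,0)=[\mathbf{e}_\rightarrow,\mathbf{e}_\uparrow,\mathbf{e}_\leftarrow,\mathbf{e}_\downarrow]$, $C_{el}(m_0,n_0)=[\mathbf{e}_\rightarrow,\mathbf{e}_\downarrow,\mathbf{e}_\uparrow,\mathbf{e}_\leftarrow]$, $C_{el}(0,n_0)=[\mathbf{e}_\downarrow,\mathbf{e}_\leftarrow,\mathbf{e}_\uparrow,\mathbf{e}_\rightarrow]$. (The eigenvalues of $U_{el}$ are $e^{-i\pi k/(m_0+n_0)}$, $k=0,\ldots,2(m_0+n_0)-1$, each of geometric multiplicity 2.) For each $\epsilon\in(0,1]$ let $U_\epsilon=SC_\epsilon$ with $C_\epsilon(x)\in\mathrm{U}(4)$ for all $x$, and write $c_{\epsilon,j,k}(x)$ for the $(j,k)$-entry of $C_\epsilon(x)$ ($j$ the row, $k$ the column). The conditions are: (i) $C_\epsilon(x)=I_4$ for $x\notin\{(0,0),(m_0,0),(m_0,n_0),(0,n_0)\}$; (ii) $|C_\epsilon(x)-C_{el}(x)|_\infty<\epsilon$ for $x\in\{(0,0),(m_0,0),(m_0,n_0),(0,n_0)\}$,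 where $|A|_\infty=\max_{j,k}|a_{j,k}|$; (iii) $c_{\epsilon,\rightarrow,\leftarrow}(0,0)=c_{\epsilon,\uparrow,\downarrow}(0,0)=c_{\epsilon,\uparrow,\downarrow}(m_0,0)=c_{\epsilon,\leftarrow,\rightarrow}(m_0,0)=c_{\epsilon,\downarrow,\uparrow}(m_0,n_0)=c_{\epsilon,\leftarrow,\rightarrow}(m_0,n_0)=c_{\epsilon,\rightarrow,\leftarrow}(0,n_0)=c_{\epsilon,\downarrow,\uparrow}(0,n_0)=0$. *)

(* Defs.v *)
From HB Require Import structures.
From mathcomp Require Import all_boot all_order all_algebra.
From mathcomp Require Import spectral ring_quotient generic_quotient.
From mathcomp Require Import all_classical all_reals all_analysis.
From mathcomp Require Import complex.

Set Implicit Arguments.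
Unset Strict Implicit.
Unset Printing Implicit Defensive.

Import Order.TTheory GRing.Theory Num.Theory.
Import numFieldNormedType.Exports.

Local Open Scope classical_set_scope.
Local Open Scope ring_scope.
Local Open Scope complex_scope.
Local Open Scope quotient_scope.

Definition twopiZ (R : realType) : {pred R[i]} :=
  fun z => `[< exists j : int, z = (2 * pi * j%:~R)%:C >].

Lemma twopiZ_zmod_closed (R : realType) : zmod_closed (@twopiZ R).
Proof.
split; first by apply/asboolP; exists 0; rewrite mulr0.
move=> x y /asboolP[j ->] /asboolP[k ->]; apply/asboolP; exists (j - k).
by rewrite intrB mulrBr rmorphB.
Qed.

HB.instance Definition _ (R : realType) :=
  GRing.isZmodClosed.Build R[i] (@twopiZ R) (@twopiZ_zmod_closed R).

Notation torusC R := (Quotient.quot (@twopiZ R)).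

Definition cexp (R : realType) (z : R[i]) : R[i] :=
  (expR (complex.Re z))%:C * (cos (complex.Im z) +i* sin (complex.Im z)).

Definition torus_Im (R : realType) (k : torusC R) : R := complex.Im (repr k).

Definition torus_exp (R : realType) (n : int) (k : torusC R) : R[i] :=
  cexp ('i * n%:~R * repr k).

(** [Im k] and [e^{i n k}] do not depend on the representative of [k]. *)
Lemma torus_Im_pi (R : realType) (z : R[i]) :
  torus_Im (\pi_(torusC R) z) = complex.Im z.
Proof.
rewrite /torus_Im; have := reprK (\pi_(torusC R) z).
move/eqP; rewrite eqmodE => /asboolP[j].
move/(congr1 (@complex.Im R)); rewrite raddfB /= => /eqP.
by rewrite subr_eq0 => /eqP.
Qed.

Lemma cexp_twopi (R : realType) (z : R[i]) (n : int) :
  cexp (z + 'i * (2 * pi * n%:~R)%:C) = cexp z.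
Proof.
have per (f : R -> R) : periodic f (pi *+ 2) ->
    forall (x : R) (m : int), f (x + 2 * pi * m%:~R) = f x.
  move=> pf x m; rewrite mulr_natl; have pn := periodicn pf; case: m => m.
    by rewrite -pmulrn mulr_natr pn.
  rewrite NegzE mulrNz -pmulrn mulrN mulr_natr -[LHS](pn m.+1).
  by rewrite addrNK.
case: z => a b; rewrite /cexp /=.
rewrite !mul0r !mul1r subr0 addr0 add0r.
by rewrite (per cos (@cosD2pi R)) (per sin (@sinD2pi R)).
Qed.

Lemma torus_exp_pi (R : realType) (n : int) (z : R[i]) :
  torus_exp n (\pi_(torusC R) z) = cexp ('i * n%:~R * z).
Proof.
rewrite /torus_exp; have := reprK (\pi_(torusC R) z).
move/eqP; rewrite eqmodE => /asboolP[j /eqP]; rewrite subr_eq => /eqP ->.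
rewrite mulrDr addrC -[RHS](@cexp_twopi R _ (n * j)).
congr (cexp (_ + _)); rewrite -mulrA; congr (_ * _).
by rewrite intrM [in RHS]mulrCA [in RHS]rmorphM /= rmorph_int.
Qed.

Definition torus_norm (R : realType) (k : torusC R) : R :=
  inf [set Normc.normc z | z in [set z : R[i] | \pi_(torusC R) z = k]].

(** Operators are given by their formula on all sequences; the Hilbert space
    is the subspace [ell2], which [walk C] and [walk_theta C theta] below
    preserve when [C] is unitary, resp. equal to [1] outside a finite set. *)
Notation state R := (int * int -> 'cV[R[i]]_4).

Definition ell2 (R : realType) : set (state R) :=
  [set u | summable [set: int * int]
             (fun x => (\sum_j Normc.normc (u x j 0) ^+ 2)%:E)].

Definition point_spectrum (R : realType) (A : state R -> state R) : set R[i] :=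
  [set lam | exists2 u, ell2 u & u != 0 /\ A u = lam *: u].

Definition gen_eigenspace (R : realType) (A : state R -> state R) (lam : R[i]) :
    set (state R) :=
  [set u | ell2 u /\ exists n, iter n (fun v => A v - lam *: v) u = 0].

Definition has_dim (K : fieldType) (V : lmodType K) (E : set V) (d : nat) :=
  exists b : 'I_d -> V,
    [/\ forall i, E (b i),
        forall c : 'I_d -> K, \sum_i c i *: b i = 0 -> forall i, c i = 0
      & forall v, E v -> exists c : 'I_d -> K, v = \sum_i c i *: b i].

(** [A] has exactly [N] eigenvalues counted with algebraic multiplicity: they
    are listed in [s] with repetitions, and [has_dim _ 0] says that a number
    outside of [s] is not an eigenvalue. *)
Definition num_eigenvalues (R : realType) (A : state R -> state R) (N : nat) :=
  exists2 s : seq R[i], size s = N &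
    forall lam, has_dim (gen_eigenspace A lam) (count_mem lam s).

Definition chL : 'I_4 := @Ordinal 4 0 isT.
Definition chR : 'I_4 := @Ordinal 4 1 isT.
Definition chD : 'I_4 := @Ordinal 4 2 isT.
Definition chU : 'I_4 := @Ordinal 4 3 isT.

Definition qw_shift (R : realType) (u : state R) : state R :=
  fun x => \col_j [:: u (x.1 + 1, x.2) chL 0; u (x.1 - 1, x.2) chR 0;
                      u (x.1, x.2 + 1) chD 0; u (x.1, x.2 - 1) chU 0]`_j.

Definition walk (R : realType) (C : int * int -> 'M[R[i]]_4) (u : state R) :
    state R :=
  qw_shift (fun x => C x *m u x).

Definition ctrans_mx (R : realType) (theta : torusC R) (x : int * int) :
    'M[R[i]]_4 :=
  diag_mx (\row_j [:: torus_exp x.1 theta; torus_exp (- x.1) theta;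
                      torus_exp x.2 theta; torus_exp (- x.2) theta]`_j).

Definition ctrans (R : realType) (theta : torusC R) (u : state R) : state R :=
  fun x => ctrans_mx theta x *m u x.

Definition ctrans_inv (R : realType) (theta : torusC R) (u : state R) :
    state R :=
  fun x => invmx (ctrans_mx theta x) *m u x.

(** [e^{-i theta} S + T(theta) V T(theta)^{-1}] with [V = U - S]. *)
Definition walk_theta (R : realType) (C : int * int -> 'M[R[i]]_4)
    (theta : torusC R) (u : state R) : state R :=
  let v := ctrans_inv theta u in
  torus_exp (-1) theta *: qw_shift u + ctrans theta (walk C v - qw_shift v).

Definition corners (m0 n0 : nat) : seq (int * int) :=
  [:: (0, 0); (m0%:Z, 0); (m0%:Z, n0%:Z); (0, n0%:Z)].

(** The matrix with columns [e_a], [e_b], [e_c], [e_d]. *)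
Definition basis_cols (R : realType) (a b c d : 'I_4) : 'M[R[i]]_4 :=
  \matrix_(i, j) (i == nth a [:: a; b; c; d] j)%:R.

Definition C_el (R : realType) (m0 n0 : nat) (x : int * int) : 'M[R[i]]_4 :=
  if x == (0, 0) then basis_cols R chU chL chR chD
  else if x == (m0%:Z, 0) then basis_cols R chR chU chL chD
  else if x == (m0%:Z, n0%:Z) then basis_cols R chR chD chU chL
  else if x == (0, n0%:Z) then basis_cols R chD chL chU chR
  else 1%:M.

(* Main.v *)
Require Import Defs.
From HB Require Import structures.
From mathcomp Require Import all_boot all_order all_algebra.
From mathcomp Require Import finmap.
From mathcomp Require Import separable.
From mathcomp Require Import spectral ring_quotient generic_quotient.
From mathcomp Require Import all_classical all_reals all_analysis.
From mathcomp Require Import complex.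
From mathcomp Require Import zify ring lra.

(** Write [q = e^{-i theta}], so that [0 < |q| < 1]. A state is read as one
    amplitude for each directed edge of the lattice: [u x j] sits on the edge
    that arrives at [x] in the direction [j]. Up to the invertible weight
    [tau q], which multiplies [u x j] by [q] to the power [x . d_j], the
    operator [U(theta)] is the untwisted walk [U = SC] ([walk_theta_tau]); only
    the space in which eigenvectors are sought has changed, and it now consists
    of the [v] with [tau q v] square-summable.

    Away from the four corners of the rectangle, [U] moves amplitudes along
    straight lines. If [U v = lam v], the weighted amplitude is therefore
    geometric of ratio [q / lam] on each half-line. When [|lam| >= |q|] it does
    not decay backwards, so every half-line that comes from infinity carries
    nothing ([no_incoming_resid]). The vanishing coin entries keep an interior
    edge from being reflected onto itself, so what remains in the rectangle runs
    along two closed loops of length [L = 2(m0 + n0)], one in each sense, and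
    leaves them only towards infinity. One turn around a loop multiplies the
    amplitude by the product [P] of the four corner coefficients met on the way:
    [U^L v = P v] at its starting point ([loop_monodromy]). Hence [lam^L = P]
    ([eigen_monodromy]). The identity
    [U^L v = lam^L v + L lam^(L-1) (U - lam) v], valid when [(U - lam)^2 v = 0],
    then excludes Jordan blocks ([no_jordan]), and an eigenvector is determined
    by one amplitude on each loop ([eigen_eq0]).

    When [|lam| < |q|] the outgoing half-lines are empty instead. Time reversal
    turns [v] into an eigenvector, for [1/lam], of a walk of the same kind
    ([rev_eigen]), so [lam^-L] is a product of entries of unitary matrices. Its
    modulus is at most [1], which contradicts [|lam| < |q| <= 1]: there are no
    such eigenvalues ([no_small_eigen]).

    Conversely each solution of [lam^L = P] gives an eigenvector that circulates
    in the loop and emits decaying rays ([loop_eigenvector]). The rays are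
    square-summable if [|lam| > |q|], that is [|P| > |q|^L]; for the elastic walk,
    where [q = 1] and [|lam| = 1], nothing leaks out and the support is finite.
    So [lam] has multiplicity the number of loops with [lam^L = P]
    ([twisted_has_dim]), and the two equations of degree [L] have [2L] roots
    altogether ([twisted_num_eigenvalues]).

    Finally, the elastic coefficients on the loops are all [1], so [P] differs
    from [1] by at most [4 eps] ([near_monodromy]). For small [eps] this gives
    [|P| > |q|^L], and a logarithm of [P] of size [O(eps)] ([log_near1]) yields
    the required [kappa] near each [2 pi k / L] ([root_near]). *)

Set Implicit Arguments.
Unset Strict Implicit.
Unset Printing Implicit Defensive.

Import Order.TTheory GRing.Theory Num.Theory.
Import numFieldNormedType.Exports.

Local Open Scope classical_set_scope.
Local Open Scope ring_scope.
Local Open Scope complex_scope.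
Local Open Scope quotient_scope.

(** * Directions and corners *)

Definition dirv (j : 'I_4) : int * int :=
  nth 0 [:: (-1, 0); (1, 0); (0, -1); (0, 1)] j.

(** A direction is an axis [a] ([false] horizontal, [true] vertical) together
    with a sign [s]. This makes the symmetries of the rectangle visible: the four
    corners and both orientations are handled by the same formulas. *)
Definition dir (a s : bool) : 'I_4 :=
  if a then (if s then chU else chD) else (if s then chR else chL).

Lemma dirP (j : 'I_4) : exists a s, j = dir a s.
Proof.
case: j => [[|[|[|[|//]]]] h]; [exists false, false | exists false, true
  | exists true, false | exists true, true]; exact: val_inj.
Qed.

Lemma sum_dir (V : zmodType) (F : 'I_4 -> V) :
  \sum_j F j = \sum_a \sum_s F (dir a s).
Proof.
rewrite !big_bool /= !big_ord_recl big_ord0 addr0 /dir.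
rewrite [RHS]addrC (addrC (F chR)) (addrC (F chU)) addrA.
by rewrite -!addrA; congr (F _ + (F _ + (F _ + F _))); apply: val_inj.
Qed.

Lemma dir_inj (a s a' s' : bool) : dir a s = dir a' s' -> a = a' /\ s = s'.
Proof. by case: a a' s s' => [] [] [] [] //=. Qed.

Definition coordinate (T : Type) (a : bool) (p : T * T) : T := if a then p.2 else p.1.

(** A corner is a pair of booleans, right or left and top or bottom; [flip a]
    goes to the other end of its side along the axis [a]. *)
Definition flip (a : bool) (c : bool * bool) : bool * bool :=
  if a then (c.1, ~~ c.2) else (~~ c.1, c.2).

(** The interior edge along the axis [a] arrives at the corner [c] in the
    direction whose sign is the coordinate of [c], since such an edge points
    outwards; the opposite direction departs from [c] into the rectangle. *)
Definition arr (c : bool * bool) (a : bool) : 'I_4 := dir a (coordinate a c).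
Definition dep (c : bool * bool) (a : bool) : 'I_4 := dir a (~~ coordinate a c).

Arguments dir : simpl never.
Arguments arr : simpl never.
Arguments dep : simpl never.

Section Rectangle.
Variables (m0 n0 : nat).

Definition pos (c : bool * bool) : int * int :=
  (if c.1 then m0%:Z else 0, if c.2 then n0%:Z else 0).

Definition len (a : bool) : nat := if a then n0 else m0.

Lemma dirvE (a s : bool) (t : nat) (x : int * int) :
  x + dirv (dir a s) *+ t =
  if a then (x.1, x.2 + (if s then t%:Z else - t%:Z))
  else (x.1 + (if s then t%:Z else - t%:Z), x.2).
Proof.
have E (y z : int * int) k : y + z *+ k = (y.1 + z.1 *+ k, y.2 + z.2 *+ k).
  elim: k y => [|k IH] y; first by rewrite !mulr0n !addr0; case: y.
  by rewrite !mulrS !addrA IH.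
by rewrite E /dirv /dir; case: a s => [] [] /=;
   rewrite ?mul0rn ?addr0 ?mulNrn ?natz.
Qed.

Lemma dirvNE (a s : bool) : - dirv (dir a s) = dirv (dir a (~~ s)).
Proof. by case: a s => [] []. Qed.

Lemma cornersP (x : int * int) :
  reflect (exists c, x = pos c) (x \in corners m0 n0).
Proof.
rewrite /corners !inE; apply: (iffP idP).
  by case/or4P => /eqP ->; [exists (false, false) | exists (true, false)
    | exists (true, true) | exists (false, true)].
by case=> [[[] []] ->]; apply/or4P; [apply: Or43 | apply: Or42
  | apply: Or44 | apply: Or41]; exact: eqxx.
Qed.

Lemma pos_corner c : pos c \in corners m0 n0.
Proof. by apply/cornersP; exists c. Qed.

Lemma pos_dep c a : pos c + dirv (dep c a) *+ len a = pos (flip a c).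
Proof.
by case: c a => [[] []] []; rewrite dirvE /pos /=; congr (_, _); lia.
Qed.

Lemma arr_flip c a : arr (flip a c) a = dep c a.
Proof. by case: a. Qed.

Hypotheses (hm0 : (0 < m0)%N) (hn0 : (0 < n0)%N).

Lemma len_gt0 a : (0 < len a)%N. Proof. by case: a. Qed.

Lemma pos_inj : injective pos.
Proof.
case=> [a b] [c d]; rewrite /pos /=; case: a b c d => [] [] [] [] //= [];
  lia.
Qed.

(** The edges that arrive at a corner from outside of the rectangle come from
    infinity without meeting another corner. *)
Lemma outer_arrival c a t : pos c - dirv (dep c a) *+ t.+1 \notin corners m0 n0.
Proof.
rewrite -mulNrn dirvNE; apply/cornersP => -[[c1 c2]]; case: c a => [d1 d2] a.
rewrite dirvE /pos; case: a c1 c2 d1 d2 => [] [] [] [] [] /= []; lia.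
Qed.

Lemma inner_free c a t : (t.+1 < len a)%N ->
  pos c + dirv (dep c a) *+ t.+1 \notin corners m0 n0.
Proof.
move=> tl; apply/cornersP => -[[c1 c2]]; move: tl; case: c a => [d1 d2] a.
rewrite dirvE /pos /len; case: a c1 c2 d1 d2 => [] [] [] [] [] /= tl []; lia.
Qed.

End Rectangle.

(** * Loops of the corner scattering *)

Lemma state_ext (R : realType) (u v : state R) :
  (forall x j, u x j 0 = v x j 0) -> u = v.
Proof.
by move=> h; apply/funext => x; apply/matrixP => j k; rewrite ord1; exact: h.
Qed.

Lemma stateBZ (R : realType) (u v : state R) (a : R[i]) x j :
  (u - a *: v) x j 0 = u x j 0 - a * v x j 0.
Proof.
have E (A B : 'cV[R[i]]_4) : (A - a *: B) j 0 = A j 0 - a * B j 0.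
  by rewrite !mxE.
exact: E.
Qed.

Section Walk.
Variables (R : realType).
Local Notation K := R[i].

Lemma walkE (C : int * int -> 'M[K]_4) (v : state R) x j :
  walk C v x j 0 = \sum_k C (x - dirv j) j k * v (x - dirv j) k 0.
Proof.
rewrite /walk /qw_shift mxE.
have sP (a b : int) (y : int * int) : (y.1 - a, y.2 - b) = y - (a, b) by [].
case: (dirP j) => a [s ->]; case: a s => [] [] /=; rewrite mxE.
- by rewrite -[x.1]subr0 sP.
- by rewrite -[x.1]subr0 -[1]opprK sP.
- by rewrite -[x.2]subr0 sP.
- by rewrite -[x.2]subr0 -[1]opprK sP.
Qed.

Lemma walk_step (C : int * int -> 'M[K]_4) (v : state R) x j :
  walk C v (x + dirv j) j 0 = \sum_k C x j k * v x k 0.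
Proof. by rewrite walkE addrK. Qed.

Lemma walk_coin1 (C : int * int -> 'M[K]_4) (v : state R) x j :
  C x = 1%:M -> walk C v (x + dirv j) j 0 = v x j 0.
Proof.
move=> h; rewrite walk_step h (bigD1 j) //= big1 => [|k kj].
  by rewrite addr0 mxE eqxx mul1r.
by rewrite mxE eq_sym (negPf kj) mul0r.
Qed.

Lemma walk_linear (C : int * int -> 'M[K]_4) (a : K) (u v : state R) :
  walk C (a *: u + v) = a *: walk C u + walk C v.
Proof.
apply: state_ext => x j; rewrite [RHS]mxE [X in _ = X + _]mxE.
rewrite !walkE mulr_sumr -big_split /=; apply: eq_bigr => i _.
by rewrite !mxE mulrDr mulrCA.
Qed.

Variables (m0 n0 : nat).
Local Notation pos := (pos m0 n0).
Local Notation len := (len m0 n0).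
Local Notation corner x := (x \in corners m0 n0).

(** Such an edge carries only what comes straight from infinity; the lines that
    avoid all corners consist of such edges. *)
Definition incoming (x : int * int) (j : 'I_4) : Prop :=
  forall t : nat, ~~ corner (x - dirv j *+ t.+1).

Definition no_incoming (v : state R) : Prop :=
  forall x j, incoming x j -> v x j 0 = 0.

(** A triple [(c, a)] stands for the interior edge arriving at [c] along the
    axis [a]. Back-reflection being excluded, its amplitude stays in the
    rectangle only by changing axis, and then arrives at the next corner along the other axis. *)
Definition turn (p : bool * bool * bool) : bool * bool * bool :=
  (flip (~~ p.2) p.1, ~~ p.2).

(** The two orbits of [turn] are the two orientations of the rectangle; both
    bottom-left arrivals serve as starting points. *)
Definition base (b : bool) : bool * bool * bool := ((false, false), b).

Definition amp (v : state R) (p : bool * bool * bool) : K :=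
  v (pos p.1) (arr p.1 p.2) 0.

Definition kappa (C : int * int -> 'M[K]_4) (p : bool * bool * bool) : K :=
  C (pos p.1) (dep p.1 (~~ p.2)) (arr p.1 p.2).

Definition monodromy (C : int * int -> 'M[K]_4) (b : bool) : K :=
  \prod_(k < 4) kappa C (iter k turn (base b)).

Lemma turn_orbit p : exists b k, p = iter k turn (base b).
Proof.
case: p => [[[] []] []]; [exists true, 2%N | exists false, 2%N
 | exists false, 3%N | exists true, 1%N | exists false, 1%N | exists true, 3%N
 | exists true, 0%N | exists false, 0%N]; by [].
Qed.

Lemma turn4 p : iter 4 turn p = p.
Proof. by case: p => [[[] []] []]. Qed.

Lemma incoming_pred x j : incoming x j -> ~~ corner (x - dirv j) /\ incoming (x - dirv j) j.
Proof.
move=> h; split=> [|t]; first exact: h 0.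
by rewrite -addrA -opprD -mulrS; apply: h.
Qed.

(** An edge that is not incoming was emitted by a last corner. Every global
    statement below is a case analysis on this alternative. *)
Lemma last_corner x j : incoming x j \/
  exists c t, x = pos c + dirv j *+ t.+1 /\
    forall i, (i < t)%N -> ~~ corner (pos c + dirv j *+ i.+1).
Proof.
have [|nin] := pselect (incoming x j); [by left | right].
move: nin => /existsNP[t0 /negP/negPn ht0].
have ex : exists t, corner (x - dirv j *+ t.+1) by exists t0.
case: (ex_minnP ex) => t ht tmin {t0 ht0}.
have [c hc] := cornersP _ _ _ ht.
have hx : x = pos c + dirv j *+ t.+1 by rewrite -hc subrK.
exists c, t; split=> // i it; apply/negP => hi.
have /tmin : corner (x - dirv j *+ (t - i.+1).+1).
  have E : t.+1 = (i.+1 + (t - i.+1).+1)%N by lia.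
  by rewrite hx {1}E mulrnDr addrA addrK.
by lia.
Qed.

Hypotheses (hm0 : (0 < m0)%N) (hn0 : (0 < n0)%N).

Lemma incoming_outer c a : incoming (pos c) (dep c a).
Proof. by move=> t; apply: outer_arrival. Qed.

Variable C : int * int -> 'M[K]_4.
Hypothesis C1 : forall x, ~~ corner x -> C x = 1%:M.
Hypothesis Crefl : forall c a, C (pos c) (dep c a) (arr c a) = 0.
Local Notation U := (walk C).

Lemma walk_free v x j : ~~ corner x -> U v (x + dirv j) j 0 = v x j 0.
Proof. by move=> /C1; exact: walk_coin1. Qed.

Lemma iter_free v x j t :
  (forall i, (i < t)%N -> ~~ corner (x + dirv j *+ i)) ->
  iter t U v (x + dirv j *+ t) j 0 = v x j 0.
Proof.
elim: t => [|t IH] h; first by rewrite mulr0n addr0.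
rewrite iterS mulrSr addrA walk_free ?h //; apply: IH => i it.
exact/h/ltnW.
Qed.

Lemma no_incoming_walk v : no_incoming v -> no_incoming (U v).
Proof.
move=> hv x j /incoming_pred[hx hi].
by rewrite -[x](subrK (dirv j)) walk_free // hv.
Qed.

Lemma no_incoming_iter v t : no_incoming v -> no_incoming (iter t U v).
Proof. by move=> hv; elim: t => //= t; apply: no_incoming_walk. Qed.

(** The arrivals from outside vanish, so a corner only scatters what the two
    interior edges bring. *)
Lemma corner_out v c s a : no_incoming v ->
  \sum_k C (pos c) (dir a s) k * v (pos c) k 0 =
  \sum_b C (pos c) (dir a s) (arr c b) * v (pos c) (arr c b) 0.
Proof.
move=> hv; rewrite sum_dir; apply: eq_bigr => b _.
rewrite big_bool /= /arr; have := hv _ _ (@incoming_outer c b).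
by rewrite /dep; case: (coordinate b c) => -> ; rewrite mulr0 ?addr0 ?add0r.
Qed.

(** Of the two interior arrivals, the one along the axis of departure would be
    reflected, and its coefficient vanishes. *)
Lemma corner_dep v c a : no_incoming v ->
  \sum_k C (pos c) (dep c (~~ a)) k * v (pos c) k 0 =
  kappa C (c, a) * amp v (c, a).
Proof.
move=> hv; rewrite corner_out // big_bool /kappa /amp /=.
by case: a => /=; rewrite Crefl mul0r ?addr0 ?add0r.
Qed.

Lemma loop_step v p : no_incoming v ->
  amp (iter (len (~~ p.2)) U v) (turn p) = kappa C p * amp v p.
Proof.
case: p => c a hv; rewrite {1}/amp /= arr_flip -pos_dep -corner_dep //.
have [t E] : exists t, len (~~ a) = t.+1.
  by exists (len (~~ a)).-1; rewrite prednK // len_gt0.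
rewrite E iterSr mulrS addrA iter_free ?walk_step // => i it.
by rewrite -addrA -mulrS inner_free // E ltnS.
Qed.

(** No eigenvalue equation is assumed: this holds for all states without
    incoming amplitude, which is what allows [no_jordan] to apply it to a
    generalised eigenvector. *)
Lemma loop_monodromy v b : no_incoming v ->
  amp (iter (2 * (m0 + n0)) U v) (base b) = monodromy C b * amp v (base b).
Proof.
move=> hv; set p := base b.
have -> : (2 * (m0 + n0) = len b + (len (~~ b) + (len b + len (~~ b))))%N.
  by case: b @p => /=; lia.
rewrite /monodromy 4!big_ord_recl big_ord0 mulr1 !iterD.
set v1 := iter _ U v; set v2 := iter _ U v1; set v3 := iter _ U v2.
have h1 : no_incoming v1 by apply: no_incoming_iter.
have h2 : no_incoming v2 by apply: no_incoming_iter.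
have h3 : no_incoming v3 by apply: no_incoming_iter.
have := @loop_step v3 (iter 3 turn p) h3.
have := @loop_step v2 (iter 2 turn p) h2.
have := @loop_step v1 (iter 1 turn p) h1.
have := @loop_step v (iter 0 turn p) hv.
(* the fourth corner leads back to the first *)
rewrite -!iterS turn4 /= !negbK => -> -> -> ->; rewrite -/p.
by ring.
Qed.

Lemma walk0 : U 0 = 0.
Proof.
apply: state_ext => x j; rewrite walkE mxE big1 // => i _.
by rewrite mxE mulr0.
Qed.

Lemma walkZ (a : K) v : U (a *: v) = a *: U v.
Proof. by rewrite -[a *: v]addr0 walk_linear walk0 addr0. Qed.

Lemma walkD u v : U (u + v) = U u + U v.
Proof. by rewrite -[u]scale1r walk_linear !scale1r. Qed.

(** Generalised eigenvectors are those killed by a power of [resid lam]. *)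
Definition resid (lam : K) (v : state R) : state R := U v - lam *: v.

Lemma residE lam v x j : resid lam v x j 0 = U v x j 0 - lam * v x j 0.
Proof. exact: stateBZ. Qed.

Lemma resid0 lam v : resid lam v = 0 -> U v = lam *: v.
Proof. by move/subr0_eq. Qed.

Lemma iter_eigen lam v n : U v = lam *: v -> iter n U v = lam ^+ n *: v.
Proof.
move=> hv; elim: n => [|n IH]; first by rewrite expr0 scale1r.
by rewrite iterS IH walkZ hv scalerA -exprSr.
Qed.

Lemma ampZ a v p : amp (a *: v) p = a * amp v p.
Proof. by rewrite /amp mxE. Qed.

Lemma ampD u v p : amp (u + v) p = amp u p + amp v p.
Proof. by rewrite /amp mxE. Qed.

Lemma eigen_monodromy lam v b : no_incoming v -> U v = lam *: v ->
  amp v (base b) != 0 -> lam ^+ (2 * (m0 + n0)) = monodromy C b.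
Proof.
move=> hv /iter_eigen he nz; apply: (mulIf nz).
by rewrite -loop_monodromy // he ampZ.
Qed.

(** The values at the two starting points propagate around both loops, hence
    to every arrival at a corner, and from the corners to every ray. *)
Lemma eigen_eq0 lam v : lam != 0 -> no_incoming v -> U v = lam *: v ->
  (forall b, amp v (base b) = 0) -> v = 0.
Proof.
move=> lam0 hv he h0.
have hs p : amp v p = 0 -> amp v (turn p) = 0.
  move=> hp; have := loop_step p hv; rewrite hp mulr0 (iter_eigen _ he) ampZ.
  by move/eqP; rewrite mulf_eq0 expf_eq0 (negPf lam0) andbF => /eqP.
have hamp p : amp v p = 0.
  have [b [k ->]] := turn_orbit p.
  by elim: k => [|k IH]; [exact: h0 | rewrite iterS; exact: hs].
apply: state_ext => x j; rewrite [RHS]mxE.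
have [hin|[c [t [hx ht]]]] := last_corner x j; first exact: hv.
have -> : v x j 0 = lam ^- t.+1 * iter t.+1 U v x j 0.
  by rewrite (iter_eigen _ he) mxE mulKf // expf_neq0.
rewrite iterSr hx mulrS addrA iter_free => [|i it]; last first.
  by rewrite -addrA -mulrS ht.
rewrite walk_step big1 ?mulr0 // => k _.
case: (dirP k) => a [s ->].
have /orP[/eqP ->|/eqP ->] : (s == coordinate a c) || (s == ~~ coordinate a c).
    by case: s (coordinate a c) => [] [].
  by have := hamp (c, a); rewrite /amp /= /arr => ->; rewrite mulr0.
by rewrite (hv (pos c)) ?mulr0 //; exact: incoming_outer.
Qed.

Lemma iter_jordan lam v g n : U v = lam *: v + g -> U g = lam *: g ->
  iter n.+1 U v = lam ^+ n.+1 *: v + (n.+1%:R * lam ^+ n) *: g.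
Proof.
move=> hv hg; elim: n => [|n IH].
  by rewrite /= expr1 expr0 mulr1 scale1r.
rewrite iterS IH walkD !walkZ hv hg scalerDr !scalerA -addrA -scalerDl.
congr (_ *: _ + _ *: _); first by rewrite -exprSr.
by rewrite -(natr1 n.+1) exprS; ring.
Qed.

(** If [g = (U - lam) v] had a nonzero amplitude on a loop, then [lam^L] would
    be the monodromy of this loop, and comparing [U^L v = lam^L v] there with
    [iter_jordan] would give [L lam^(L-1) g = 0]. *)
Lemma no_jordan lam v : lam != 0 -> no_incoming v ->
  resid lam (resid lam v) = 0 -> resid lam v = 0.
Proof.
move=> lam0 hv; set g := resid lam v => /resid0 hg.
have hvg : U v = lam *: v + g by rewrite addrC subrK.
have ig : no_incoming g.
  move=> x j hx; rewrite residE no_incoming_walk // hv //.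
  by rewrite mulr0 subr0.
apply: (eigen_eq0 lam0 ig hg) => b; apply/eqP/negPn/negP => nz.
have hm := eigen_monodromy ig hg nz.
have [n hn] : exists n, (2 * (m0 + n0) = n.+1)%N.
  by exists (2 * (m0 + n0)).-1; lia.
have := loop_monodromy b hv; rewrite -hm hn (iter_jordan _ hvg hg) ampD !ampZ.
move=> /eqP; rewrite addrC -subr_eq0 addrK !mulf_eq0 (negPf nz) orbF.
by rewrite pnatr_eq0 expf_eq0 (negPf lam0) andbF.
Qed.

End Walk.

(** * Decay at infinity *)

(** The scalar product of [x] with the direction [j]: the position of [x] along
    the lines of direction [j]. *)
Definition expo (x : int * int) (j : 'I_4) : int :=
  x.1 * (dirv j).1 + x.2 * (dirv j).2.

Definition size1 (x : int * int) : nat := (`|x.1| + `|x.2|)%N.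

Lemma expoD x j t : expo (x + dirv j *+ t) j = expo x j + t%:Z.
Proof.
case: (dirP j) => a [s ->]; rewrite dirvE /expo /dirv /dir.
by case: a s => [] [] /=; lia.
Qed.

Lemma size1D x j t :
  (size1 (x + dirv j *+ t)%R <= t + size1 x)%N /\
  (t <= size1 (x + dirv j *+ t)%R + size1 x)%N.
Proof.
case: (dirP j) => a [s ->]; rewrite dirvE /size1.
by case: a s => [] [] /=; lia.
Qed.

Lemma size1_pos m0 n0 c : (size1 (pos m0 n0 c) <= m0 + n0)%N.
Proof. by case: c => [[] []]; rewrite /size1 /pos /=; lia. Qed.

Definition opposite (j : 'I_4) : 'I_4 := nth chL [:: chR; chL; chU; chD] j.

Lemma opposite_dir a s : opposite (dir a s) = dir a (~~ s).
Proof. by case: a s => [] []. Qed.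

Lemma oppositeK : involutive opposite.
Proof. by move=> j; case: (dirP j) => a [s ->]; rewrite !opposite_dir negbK. Qed.

Lemma dirv_opposite j : dirv (opposite j) = - dirv j.
Proof. by case: (dirP j) => a [s ->]; rewrite opposite_dir dirvNE. Qed.

Lemma expo_opposite x j : expo x (opposite j) = - expo x j.
Proof. by rewrite /expo dirv_opposite !mulrN -opprD. Qed.

Section Decay.
Variables (R : realType).
Local Notation K := R[i].

(** For [q = e^{-i theta}] this is the complex translation [T(theta)]. *)
Definition tau (q : K) (v : state R) : state R :=
  fun x => \col_j (q ^ expo x j * v x j 0).

(** Decay to zero is weaker than square-summability, but it is obviously
    preserved by [walk] and it already kills the amplitudes on half-lines. *)
Definition decays (v : state R) : Prop :=
  forall e : K, 0 < e ->
    exists N : nat, forall x j, (N <= size1 x)%N -> `|v x j 0| < e.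

Lemma tauE q v x j : tau q v x j 0 = q ^ expo x j * v x j 0.
Proof. by rewrite mxE. Qed.

Lemma tauK q v : q != 0 -> tau q (tau q^-1 v) = v.
Proof.
move=> q0; apply: state_ext => x j; rewrite !tauE exprz_inv.
by rewrite mulrA -expfzDr // subrr expr0z mul1r.
Qed.

Lemma tau_lin q (a : K) u v : tau q (u - a *: v) = tau q u - a *: tau q v.
Proof.
apply: state_ext => x j; rewrite tauE (stateBZ u v) (stateBZ (tau q u)) !tauE.
by ring.
Qed.

Lemma tau0 q : tau q 0 = 0.
Proof. by apply: state_ext => x j; rewrite tauE [X in _ * X]mxE mulr0 mxE. Qed.

Lemma tauZ q a v : tau q (a *: v) = a *: tau q v.
Proof.
have := tau_lin q (- a) 0 v; rewrite tau0 scaleNr opprK !add0r => ->.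
by rewrite scaleNr opprK.
Qed.

Lemma tauD q u v : tau q (u + v) = tau q u + tau q v.
Proof. by have := tau_lin q (-1) u v; rewrite !scaleN1r !opprK. Qed.

Lemma decaysB (u v : state R) (a : K) : decays u -> decays v -> decays (u - a *: v).
Proof.
move=> hu hv e e0; have a0 : 0 < `|a| + 1 by rewrite ltr_wpDl.
have e2 : 0 < e / 2 by rewrite divr_gt0.
have [N1 h1] := hu _ e2; have [N2 h2] := hv (e / 2 / (`|a| + 1)) (divr_gt0 e2 a0).
exists (N1 + N2)%N => x j hx.
rewrite stateBZ; apply: le_lt_trans (ler_normB _ _) _.
rewrite [e]splitr normrM; apply: ltr_leD; first by apply: h1; lia.
have /ltW := h2 x j ltac:(lia); rewrite ler_pdivlMr // => h.
apply: le_trans h; rewrite mulrDr mulr1 mulrC lerDl; exact: normr_ge0.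
Qed.

Variables (m0 n0 : nat).
Local Notation corner x := (x \in corners m0 n0).
Variable C : int * int -> 'M[K]_4.
Hypothesis C1 : forall x, ~~ corner x -> C x = 1%:M.
Local Notation U := (walk C).

Lemma far_free x : (m0 + n0 < size1 x)%N -> ~~ corner x.
Proof.
move=> hx; apply/cornersP => -[[c1 c2] E]; move: hx; rewrite E /pos /size1 /=.
by case: c1 c2 {E} => [] []; lia.
Qed.

Lemma decays_walk q v : q != 0 -> decays (tau q v) -> decays (tau q (U v)).
Proof.
move=> q0 hv e e0; have q1 : 0 < `|q| by rewrite normr_gt0.
have [N hN] := hv (e / `|q|) (divr_gt0 e0 q1).
exists (N + m0 + n0).+2 => x j hx.
have [y Ey] : exists y, x = y + dirv j by exists (x - dirv j); rewrite subrK.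
have hy : (N + m0 + n0 < size1 y)%N.
  by have := leq_trans hx (_ : size1 x <= 1 + size1 y)%N; rewrite ltnS; apply;
    rewrite Ey; exact: (size1D y j 1).1.
rewrite tauE Ey (walk_free C1); last by apply: far_free; lia.
have := hN y j ltac:(lia); rewrite tauE -[dirv j]mulr1n expoD.
rewrite [q ^ (_ + 1)]expfzDr // -exprnP expr1.
by rewrite ltr_pdivlMr // -normrM mulrAC.
Qed.

(** Going backwards along an incoming half-line multiplies the weighted
    amplitude by [lam / q] at each step; it cannot decay if [|q| <= |lam|]. Only
    [(U - lam) v] is assumed to have no incoming amplitude, so that the lemma can
    be iterated on generalised eigenvectors. *)
Lemma no_incoming_resid q lam v : q != 0 -> `|q| <= `|lam| ->
  decays (tau q v) -> no_incoming m0 n0 (resid C lam v) -> no_incoming m0 n0 v.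
Proof.
move=> q0 ql hd hg x j hx.
have step n : v (x - dirv j *+ n) j 0 = lam ^+ n * v x j 0 /\
    incoming m0 n0 (x - dirv j *+ n) j.
  elim: n => [|n [IH hi]]; first by rewrite mulr0n subr0 expr0 mul1r.
  have [hc hi'] := incoming_pred hi.
  have E : x - dirv j *+ n.+1 = x - dirv j *+ n - dirv j.
    by rewrite mulrSr opprD addrA.
  rewrite E; split=> //; have := hg _ _ hi; rewrite residE.
  rewrite -{1}[x - dirv j *+ n](subrK (dirv j)) (walk_free C1) // => /subr0_eq ->.
  by rewrite IH mulrA -exprS.
apply/eqP/negPn/negP => nz.
(* the value at x itself is taken as the threshold that decay must beat *)
have e0 : 0 < `|tau q v x j 0|.
  by rewrite normr_gt0 tauE mulf_neq0 // expfz_neq0.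
have [N hN] := hd _ e0.
have [h1 h2] := size1D x (opposite j) (N + size1 x).
have := hN (x - dirv j *+ (N + size1 x)) j.
rewrite -mulNrn -dirv_opposite => /(_ _)/wrap[]; first by rewrite -(leq_add2r (size1 x)).
move: (N + size1 x)%N => n; rewrite dirv_opposite mulNrn !tauE (step n).1.
have -> : expo (x - dirv j *+ n) j = expo x j - n%:Z.
  by rewrite -{2}[x](subrK (dirv j *+ n)) expoD addrK.
rewrite expfzDr // !normrM -mulrA ltr_pM2l; last by rewrite normr_gt0 expfz_neq0.
rewrite mulrA gtr_pMl ?normr_gt0 // -exprnN normfV !normrX mulrC.
rewrite ltr_pdivrMr ?exprn_gt0 ?normr_gt0 // mul1r => /lt_geF.
by rewrite lerXn2r // nnegrE.
Qed.

End Decay.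

(** * Time reversal *)

Section Reversal.
Variables (R : realType).
Local Notation K := R[i].
Implicit Types (C : int * int -> 'M[K]_4) (v : state R).

(** Time reversal sends the edge arriving at [x] in direction [j] to the same
    edge run backwards, which arrives at [x - d_j] in the opposite direction. *)
Definition rev_state (v : state R) : state R :=
  fun x => \col_j v (x - dirv j) (opposite j) 0.

(** The conjugate transpose undoes the scattering of a unitary coin; reading it
    on reversed edges makes the inverse walk a walk again. *)
Definition rev_coin C (x : int * int) : 'M[K]_4 :=
  \matrix_(k, j) Num.conj (C x (opposite j) (opposite k)).

Lemma sum_opposite (F : 'I_4 -> K) : \sum_j F (opposite j) = \sum_j F j.
Proof. by rewrite [RHS](reindex_inj (inv_inj oppositeK)). Qed.

Lemma unitary_col (M : 'M[K]_4) k l : M \is unitarymx ->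
  \sum_i Num.conj (M i k) * M i l = (k == l)%:R.
Proof.
move=> /unitarymxP/mulmx1C/matrixP/(_ k l); rewrite !mxE => <-.
by apply: eq_bigr => i _; rewrite !mxE.
Qed.

Lemma unitary_row (M : 'M[K]_4) k l : M \is unitarymx ->
  \sum_j M k j * Num.conj (M l j) = (k == l)%:R.
Proof.
move=> /unitarymxP/matrixP/(_ k l); rewrite !mxE => <-.
by apply: eq_bigr => i _; rewrite !mxE.
Qed.

Lemma unitary_entry (M : 'M[K]_4) k l : M \is unitarymx -> `|M k l| <= 1.
Proof.
move=> /(unitary_row k k); rewrite eqxx mulr1n (bigD1 l) //= -normCK => h.
rewrite -(@expr_le1 _ 2) // -h lerDl sumr_ge0 // => j _.
exact: mul_conjC_ge0.
Qed.

Lemma rev_eigen C lam v : lam != 0 -> (forall x, C x \is unitarymx) ->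
  walk C v = lam *: v -> walk (rev_coin C) (rev_state v) = lam^-1 *: rev_state v.
Proof.
move=> lam0 hC hv; apply: state_ext => x j.
rewrite walkE [RHS]mxE [rev_state _ _ _ _]mxE; set y := x - dirv j.
apply: (mulfI lam0); rewrite mulVKf //.
have E k : lam * v (y + dirv k) k 0 = \sum_l C y k l * v y l 0.
  by rewrite -walk_step hv mxE.
rewrite -sum_opposite mulr_sumr.
under eq_bigr => k _.
  rewrite /rev_coin /rev_state !mxE oppositeK dirv_opposite opprK mulrCA E mulr_sumr.
  under eq_bigr do rewrite mulrA.
over.
rewrite exchange_big /= (bigD1 (opposite j)) //= [X in _ + X]big1 => [|l lj].
  rewrite addr0 -mulr_suml.
  by rewrite unitary_col // eqxx mul1r.
by rewrite -mulr_suml unitary_col // eq_sym (negPf lj) mul0r.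
Qed.

(** Reversing a direction changes the sign of the position along it, so the
    weight [q] becomes [q^-1], up to the factor due to the unit shift. *)
Lemma rev_decays (q : K) v : q != 0 -> decays (tau q v) ->
  decays (tau q^-1 (rev_state v)).
Proof.
move=> q0 hv e e0; have q1 : 0 < `|q| by rewrite normr_gt0.
have [N hN] := hv (e * `|q|) (mulr_gt0 e0 q1).
exists N.+1 => x j hx; set y := x - dirv j.
have Ey : y = x + dirv (opposite j) *+ 1 by rewrite mulr1n dirv_opposite.
have hy : (N <= size1 y)%N.
  rewrite -ltnS; apply: leq_trans hx _.
  have Ex : x = y + dirv j *+ 1 by rewrite mulr1n subrK.
  by rewrite Ex; exact: (size1D y j 1).1.
have := hN y (opposite j) hy.
rewrite !tauE {1}Ey expoD [q ^ (_ + _)]expfzDr // -exprnP expr1.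
rewrite expo_opposite -exprz_inv mxE -/y => h.
by rewrite -(ltr_pM2r q1) -normrM mulrAC.
Qed.

Lemma rev_coin1 C x : C x = 1%:M -> rev_coin C x = 1%:M.
Proof.
move=> h; apply/matrixP => k j; rewrite !mxE h mxE conjC_nat.
by rewrite (inj_eq (inv_inj oppositeK)) eq_sym.
Qed.

Variables (m0 n0 : nat) (hm0 : (0 < m0)%N) (hn0 : (0 < n0)%N).
Local Notation pos := (pos m0 n0).
Local Notation corner x := (x \in corners m0 n0).
Variable C : int * int -> 'M[K]_4.
Hypothesis Cuni : forall x, C x \is unitarymx.
Hypothesis C1 : forall x, ~~ corner x -> C x = 1%:M.
Hypothesis Crefl : forall c a, C (pos c) (dep c a) (arr c a) = 0.

Lemma rev_coin_refl c a : rev_coin C (pos c) (dep c a) (arr c a) = 0.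
Proof.
rewrite mxE /arr /dep !opposite_dir negbK; have := Crefl c a.
by rewrite /dep /arr => ->; rewrite conjC0.
Qed.

Lemma rev_state_eq0 v : rev_state v = 0 -> v = 0.
Proof.
move=> h; apply: state_ext => x j; rewrite mxE.
have := congr1 (fun u : state R => u (x - dirv j) (opposite j) 0) h.
by rewrite !mxE dirv_opposite opprK subrK oppositeK.
Qed.

Lemma walk_eq0 v : walk C v = 0 -> v = 0.
Proof.
move=> h; apply/funext => x; have hx : C x *m v x = 0.
  by apply/matrixP => j z; rewrite ord1 mxE -walk_step h !mxE.
by rewrite -[v x]mul1mx -(mulVmx (unitarymx_unit (Cuni x))) -mulmxA hx mulmx0.
Qed.

(** The reversed state is an eigenvector for [lam^-1] with weight [q^-1], and
    [|q^-1| < |lam^-1|]: the analysis of loops applies to it. Its monodromies are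
    products of entries of unitary matrices, hence at most [1] in modulus, while
    [|lam^-1| > 1]. *)
Lemma no_small_eigen q lam v : q != 0 -> `|q| <= 1 -> `|lam| < `|q| ->
  decays (tau q v) -> walk C v = lam *: v -> v = 0.
Proof.
move=> q0 q1 lq hd hv.
have [lam0|lam0] := eqVneq lam 0; first by apply: walk_eq0; rewrite hv lam0 scale0r.
have hr := rev_eigen lam0 Cuni hv.
have rC1 x : ~~ corner x -> rev_coin C x = 1%:M by move=> /C1/rev_coin1.
have q0' : q^-1 != 0 by rewrite invr_eq0.
have hq : `|q^-1| <= `|lam^-1|.
  by rewrite !normfV lef_pV2 ?posrE ?normr_gt0 // ltW.
have hi : no_incoming m0 n0 (rev_state v).
  apply: (no_incoming_resid rC1 q0' hq (rev_decays q0 hd)).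
  by rewrite /resid hr subrr => x j _; rewrite mxE.
apply: rev_state_eq0.
apply: (eigen_eq0 hm0 hn0 rC1 rev_coin_refl _ hi hr); first by rewrite invr_eq0.
move=> b; apply/eqP/negPn/negP => nz.
have := eigen_monodromy hm0 hn0 rC1 rev_coin_refl hi hr nz.
move/(congr1 Num.norm)/eqP; rewrite gt_eqF //.
apply: (@le_lt_trans _ _ 1).
  rewrite normr_prod; apply: prodr_ile1 => k _; rewrite normr_ge0 /kappa mxE.
  by rewrite norm_conjC unitary_entry.
have L0 : (2 * (m0 + n0) != 0)%N by lia.
by rewrite normrX normfV exprn_egt1 // invf_gt1 ?normr_gt0 // (lt_le_trans lq).
Qed.

(** For [|q| <= |lam|] the chain [v, (U - lam) v, ...] is treated from its end,
    clearing incoming amplitudes and Jordan blocks at the same time; for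
    [|lam| < |q|] each member of the chain vanishes in turn. *)
Lemma gen_eigenP q lam v n : q != 0 -> `|q| <= 1 -> decays (tau q v) ->
  iter n (resid C lam) v = 0 ->
  v = 0 \/ [/\ `|q| <= `|lam|, no_incoming m0 n0 v & walk C v = lam *: v].
Proof.
move=> q0 q1 hd hn.
have hdr u : decays (tau q u) -> decays (tau q (resid C lam u)).
  move=> hu; have := decaysB lam (decays_walk C1 q0 hu) hu.
  by rewrite -tau_lin.
have [ql|lq] := real_leP (normr_real q) (normr_real lam).
  right; suff [h1 h2] : no_incoming m0 n0 v /\ resid C lam v = 0.
    by split=> //; apply: resid0.
  elim: n v hd hn => [|n IH] v hd.
    by move=> /= ->; split=> [x j _|]; rewrite ?mxE // /resid walk0 scaler0 subrr.
  rewrite iterSr => hn; have [h1 h2] := IH _ (hdr _ hd) hn.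
  have hi := no_incoming_resid C1 q0 ql hd h1.
  split=> //; apply: (no_jordan hm0 hn0 C1 Crefl _ hi h2).
  by rewrite -normr_gt0 (lt_le_trans _ ql) // normr_gt0.
left; elim: n v hd hn => [|n IH] v hd //=; rewrite -iterS iterSr => hn.
by apply: (no_small_eigen q0 q1 lq hd); apply: resid0; apply: IH hn; apply: hdr.
Qed.

End Reversal.

(** * Square-summability *)

Section SquareSummable.
Variables (R : realType).
Local Notation K := R[i].

Lemma normc_nneg (z : K) : 0 <= Normc.normc z.
Proof. by case: z => a b; exact: sqrtr_ge0. Qed.
Local Hint Resolve normc_nneg : core.

Lemma esum_geometric_nat (c r : R) : 0 <= c -> 0 < r < 1 ->
  (\esum_(n in [set: nat]) (c * r ^+ n)%:E <= (c * (1 - r)^-1)%:E)%E.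
Proof.
move=> c0 /andP[r0 r1].
have p0 n : (0 <= (c * r ^+ n)%:E)%E by rewrite lee_fin mulr_ge0 // exprn_ge0 // ltW.
rewrite -nneseries_esumT //; apply: lime_le.
  by apply: is_cvg_nneseries => n _ _; exact: p0.
apply: nearW => n; rewrite sumEFin lee_fin.
by apply: (geometric_le_lim n c0 r0); rewrite ger0_norm ?ltW.
Qed.

Lemma esum_geometric_int (c r : R) : 0 <= c -> 0 < r < 1 ->
  (\esum_(k in [set: int]) (c * r ^+ `|k|%N)%:E <= (c * (2 * (1 - r)^-1))%:E)%E.
Proof.
move=> c0 hr; have /andP[r0 r1] := hr.
have p0 (k : int) : (0 <= (c * r ^+ `|k|%N)%:E)%E.
  by rewrite lee_fin mulr_ge0 // exprn_ge0 // ltW.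
rewrite (esumID (range Posz)); last by move=> k _; exact: p0.
rewrite mulrCA mulr2n mulrDl !mul1r EFinD; apply: leeD.
  rewrite setTI esum_image; last by move=> a b _ _ [].
  exact: esum_geometric_nat.
have -> : [set: int] `&` ~` range Posz = range Negz.
  apply/seteqP; split=> [[k|k] [_ h]|_ [k _ <-]] //=; first by case: h; exists k.
    by exists k.
  by split=> // -[].
rewrite esum_image; last by move=> a b _ _ [].
apply: le_trans (esum_geometric_nat c0 hr); apply: le_esum => k _.
by rewrite lee_fin ler_wpM2l //= ler_wiXn2l ?ltW.
Qed.

(** The sum over the plane factors into two geometric sums over the integers;
    squaring the terms does no harm as [r^2 <= r]. *)
Lemma ell2_geometric (u : state R) (M r : R) : 0 < r < 1 ->
  (forall x j, Normc.normc (u x j 0) <= M * r ^+ size1 x) -> ell2 u.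
Proof.
move=> hr hu; have /andP[r0 r1] := hr; have r0' := ltW r0; rewrite /ell2 /= /summable.
have M0 : 0 <= M.
  by rewrite -(pmulr_lge0 _ (exprn_gt0 (size1 (0, 0)) r0)); apply: le_trans (hu _ chL).
set G := 2 * (1 - r)^-1; have G0 : 0 <= G.
  by rewrite mulr_ge0 // invr_ge0 subr_ge0 ltW.
apply: (@le_lt_trans _ _ (4 * M ^+ 2 * G * G)%:E); last exact: ltry.
apply: (@le_trans _ _ (\esum_(k in [set: int] `*`` (fun=> [set: int]))
    ((4 * M ^+ 2 * r ^+ `|k.1|%N) * r ^+ `|k.2|%N)%:E)%E).
  have -> : [set: int] `*`` (fun=> [set: int]) = [set: int * int].
    by apply/seteqP; split.
  apply: le_esum => x _; rewrite gee0_abs ?lee_fin; last first.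
    by apply: sumr_ge0 => j _; rewrite exprn_ge0.
  have -> : 4 * M ^+ 2 * r ^+ `|x.1| * r ^+ `|x.2| = (M ^+ 2 * r ^+ size1 x) *+ 4.
    by rewrite -mulr_natl /size1 exprD; ring.
  apply: (@le_trans _ _ (\sum_(j < 4) M ^+ 2 * r ^+ size1 x)); last first.
    by rewrite sumr_const card_ord.
  apply: ler_sum => j _; apply: (@le_trans _ _ ((M * r ^+ size1 x) ^+ 2)).
    by rewrite lerXn2r ?nnegrE // (le_trans _ (hu x j)).
  rewrite exprMn ler_wpM2l ?exprn_ge0 // -exprM ler_wiXn2l ?ltW //.
  by rewrite leq_pmulr.
rewrite -(@esum_esum _ _ _ _ _ (fun a b => (4 * M ^+ 2 * r ^+ `|a|%N * r ^+ `|b|%N)%:E));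
  last first.
  by move=> a b _ _; rewrite lee_fin !mulr_ge0 ?exprn_ge0.
have m0 : 0 <= 4 * M ^+ 2 by rewrite mulr_ge0 ?exprn_ge0.
have c0 : 0 <= 4 * M ^+ 2 * G by rewrite mulr_ge0.
apply: (le_trans _ (esum_geometric_int c0 hr)); apply: le_esum => a _.
rewrite [4 * M ^+ 2 * G * _]mulrAC; apply: esum_geometric_int => //.
by rewrite mulr_ge0 ?exprn_ge0.
Qed.

Lemma ell2_geometricC (u : state R) (M r : K) : 0 < r < 1 ->
  (forall x j, `|u x j 0| <= M * r ^+ size1 x) -> ell2 u.
Proof.
case: r => r s; rewrite !ltcE /= => /andP[/andP[/eqP -> r0] /andP[_ r1]] hu.
have [N EM] : exists N : R, M = N%:C.
  have := le_trans (normr_ge0 _) (hu (0, 0) chL); rewrite expr0 mulr1.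
  by case: M {hu} => a b; rewrite lecE /= => /andP[/eqP -> _]; exists a.
apply: (@ell2_geometric u N r); first by rewrite r0.
move=> x j; rewrite -lecR; apply: le_trans (hu x j) _.
by rewrite EM rmorphM rmorphXn.
Qed.

(** An infinite set of points where the terms of a sum are at least [d^2] has
    finite subsets with arbitrarily large partial sums. *)
Lemma ell2_decays (u : state R) : ell2 u -> decays u.
Proof.
rewrite /ell2 /= /summable; pose f x := \sum_j Normc.normc (u x j 0) ^+ 2.
move=> hf e e0.
have f0 x : 0 <= f x by apply: sumr_ge0 => j _; rewrite exprn_ge0.
have [d d0 Ee] : exists2 d : R, 0 < d & e = d%:C.
  by case: e e0 => a b; rewrite ltcE /= => /andP[/eqP -> a0]; exists a.
set A := [set x | d ^+ 2 <= f x].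
have fA : finite_set A.
  apply: contrapT => iA; move: hf; rewrite ltNge => /negP; apply.
  rewrite leye_eq; apply/eqP/eqyP => t t0.
  have [n hn] : exists n : nat, t <= d ^+ 2 *+ n.
    exists (Num.bound (t / d ^+ 2)).
    rewrite -mulr_natl -ler_pdivrMr ?exprn_gt0 //.
    by apply/ltW/archi_boundP; rewrite divr_ge0 ?exprn_ge0 // ltW.
  have [B BA cB] := infinite_set_fset n iA.
  apply: esum_ge; exists [set` B]; first by split.
  rewrite fsbig_finite //= set_fsetK.
  apply: (@le_trans _ _ (\sum_(x <- B) (d ^+ 2)%:E)%E).
    rewrite sumEFin lee_fin (le_trans hn) // big_const_seq count_predT iter_addr_0.
    by rewrite ler_wpMn2l ?exprn_ge0 // ltW.
  rewrite big_seq [leRHS]big_seq; apply: lee_sum => x xB.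
  by rewrite lee_fin ger0_norm; [exact: (BA x xB) | exact: (f0 x)].
have /finite_fsetP[B BA] := fA.
exists (\max_(x <- B) size1 x).+1 => x j hx.
have xA : ~ A x.
  rewrite BA /= => xB; move: hx; rewrite ltnNge => /negP; apply.
  exact: leq_bigmax_seq.
have {}xA : f x < d ^+ 2 by rewrite ltNge; apply/negP.
rewrite Ee -[X in X < _]/((Normc.normc (u x j 0))%:C) ltcR.
rewrite -(@ltr_pXn2r _ 2) ?nnegrE ?normc_nneg ?(ltW d0) //; apply: le_lt_trans xA.
by rewrite /f (bigD1 j) //= lerDl sumr_ge0 // => k _; rewrite exprn_ge0.
Qed.

End SquareSummable.

(** * Eigenvectors carried by a loop *)

Section Eigenvector.
Variables (R : realType).
Local Notation K := R[i].
Variables (m0 n0 : nat) (hm0 : (0 < m0)%N) (hn0 : (0 < n0)%N).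
Local Notation pos := (pos m0 n0).
Local Notation len := (len m0 n0).
Local Notation corner x := (x \in corners m0 n0).
Variable C : int * int -> 'M[K]_4.
Hypothesis C1 : forall x, ~~ corner x -> C x = 1%:M.
Hypothesis Crefl : forall c a, C (pos c) (dep c a) (arr c a) = 0.
Variables (lam : K) (g : bool * bool * bool -> K).
Hypothesis lam0 : lam != 0.

(** Only the interior arrivals contribute: the state under construction has no
    incoming amplitude. *)
Definition departure (c : bool * bool) (j : 'I_4) : K :=
  \sum_b C (pos c) j (arr c b) * g (c, b).

(** The value that the eigenvalue equation forces at [x] from the last corner
    before [x]. The sum over [c] has one term: it only names that corner. *)
Definition emitted (x : int * int) (j : 'I_4) : K :=
  match pselect (exists t, corner (x - dirv j *+ t.+1)) with
  | left h => let t := ex_minn h in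
      lam ^- t.+1 * \sum_(c | pos c == x - dirv j *+ t.+1) departure c j
  | right _ => 0
  end.

Definition loop_state : state R := fun x => \col_j emitted x j.

Lemma emitted_incoming x j : incoming m0 n0 x j -> emitted x j = 0.
Proof. by move=> h; rewrite /emitted; case: pselect => // -[t ht]; case: (negP (h t)). Qed.

Lemma emittedE c j t :
  (forall i, (i < t)%N -> ~~ corner (pos c + dirv j *+ i.+1)) ->
  emitted (pos c + dirv j *+ t.+1) j = lam ^- t.+1 * departure c j.
Proof.
move=> h; rewrite /emitted; case: pselect => [e|[]]; last first.
  by exists t; rewrite addrK pos_corner.
case: ex_minnP => s hs smin; have /smin st : corner (pos c + dirv j *+ t.+1 - dirv j *+ t.+1).
  by rewrite addrK pos_corner.
have -> : s = t.
  apply/eqP; rewrite eqn_leq st /= leqNgt; apply/negP => lt_st.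
  have /h/negP : (t - s.+1 < t)%N by lia.
  apply; have E : t.+1 = ((t - s.+1).+1 + s.+1)%N by lia.
  by move: hs; rewrite E mulrnDr addrA addrK.
by rewrite addrK (big_pred1 c) // => c'; rewrite (inj_eq (pos_inj hm0 hn0)).
Qed.

(** [g] solves the eigenvalue equation along the loops; the next lemmas extend
    it to the whole lattice. *)
Hypothesis gloop : forall p, g (turn p) = lam ^- len (~~ p.2) * (kappa m0 n0 C p * g p).

Lemma departure_dep c a : departure c (dep c (~~ a)) = kappa m0 n0 C (c, a) * g (c, a).
Proof.
by rewrite /departure big_bool /kappa /=; case: a; rewrite /= Crefl mul0r ?addr0 ?add0r.
Qed.

Lemma no_incoming_loop_state : no_incoming m0 n0 loop_state.
Proof. by move=> x j h; rewrite mxE emitted_incoming. Qed.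

Lemma amp_loop_state p : amp m0 n0 loop_state p = g p.
Proof.
have -> : p = turn (flip p.2 p.1, ~~ p.2) by case: p => [[[] []] []].
move: (flip _ _, _) => {p} [c a]; rewrite gloop /amp /= mxE arr_flip -pos_dep.
have [t E] : exists t, len (~~ a) = t.+1.
  by exists (len (~~ a)).-1; rewrite prednK // len_gt0.
rewrite E emittedE ?departure_dep // => i it.
by rewrite inner_free // E ltnS.
Qed.

Lemma loop_state_eigen : walk C loop_state = lam *: loop_state.
Proof.
apply: state_ext => x j; rewrite [RHS]mxE.
have [/cornersP[c hc]|hx] := boolP (corner (x - dirv j)).
  have Ex : x = pos c + dirv j *+ 1 by rewrite mulr1n -hc subrK.
  rewrite [in RHS]Ex [in RHS]mxE emittedE // expr1 mulrA divff // mul1r.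
  rewrite Ex mulr1n walk_step; case: (dirP j) => a [s ->].
  rewrite corner_out //; last exact: no_incoming_loop_state.
  by apply: eq_bigr => b _; rewrite -[X in _ * X]/(amp _ _ _ (c, b)) amp_loop_state.
rewrite -[in LHS](subrK (dirv j) x) (walk_free C1) //.
have [hi|[c [t [Ex ht]]]] := last_corner m0 n0 (x - dirv j) j.
  rewrite !no_incoming_loop_state ?mulr0 // => -[|t]; first by rewrite mulr1n.
  by have := hi t; rewrite -addrA -opprD -mulrS.
rewrite !mxE Ex emittedE //.
have {}Ex : x = pos c + dirv j *+ t.+2.
  by rewrite mulrSr addrA -Ex subrK.
rewrite Ex emittedE => [|i it]; first by rewrite [lam ^+ t.+2]exprS invfM -mulrA mulVKf.
have [->|nit] := eqVneq i t; last by apply: ht; lia.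
by move: hx; rewrite Ex mulrSr addrA addrK.
Qed.

Variable (q : K).
Hypotheses (q0 : q != 0) (ql : `|q| <= `|lam|).
Hypothesis leak : `|q| < `|lam| \/ forall c a, departure c (arr c a) = 0.

(** If [|q| < |lam|] the outgoing rays decay geometrically. Otherwise nothing
    leaves the rectangle, and a function of bounded support is below any
    geometric profile, here of ratio one half. *)
Lemma loop_state_ell2 : ell2 (tau q loop_state).
Proof.
pose B := \sum_c \sum_j `|q ^ expo (pos c) j * departure c j|.
have hB c j : `|q ^ expo (pos c) j * departure c j| <= B.
  rewrite /B (bigD1 c) //= (bigD1 j) //= -addrA lerDl addr_ge0 //.
    by rewrite sumr_ge0.
  by rewrite sumr_ge0 // => c' _; rewrite sumr_ge0.
have B0 : 0 <= B := le_trans (normr_ge0 _) (hB (false, false) chL).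
have l1 : 0 < `|lam| by rewrite normr_gt0.
have q1 : 0 < `|q| by rewrite normr_gt0.
pose r := `|q| / `|lam|.
have r0 : 0 < r by rewrite divr_gt0.
have r1 : r <= 1 by rewrite ler_pdivrMr // mul1r.
have tE c j t : (forall i, (i < t)%N -> ~~ corner (pos c + dirv j *+ i.+1)) ->
    `|tau q loop_state (pos c + dirv j *+ t.+1) j 0| <= B * r ^+ t.+1.
  move=> h; rewrite tauE mxE emittedE // expoD [q ^ (_ + _)]expfzDr // -exprnP.
  rewrite mulrACA [q ^+ _ * _]mulrC mulrA !normrM normfV !normrX -mulrA.
  set A := `|q ^ _|; set D := `|departure _ _|.
  have -> : A * `|lam| ^- t.+1 * (D * `|q| ^+ t.+1) = A * D * r ^+ t.+1.
    rewrite /r exprMn exprVn -!mulrA; congr (_ * _); rewrite mulrCA.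
    by congr (_ * _); rewrite mulrC.
  by rewrite ler_wpM2r ?exprn_ge0 ?(ltW r0) // /A /D -normrM hB.
have size_le c j t : (size1 (pos c + dirv j *+ t.+1)%R <= t.+1 + (m0 + n0))%N.
  by apply: leq_trans (size1D _ _ _).1 _; rewrite leq_add2l size1_pos.
case: leak => [lt_ql|hleak].
  have r1' : r < 1 by rewrite ltr_pdivrMr // mul1r.
  apply: (@ell2_geometricC _ _ (B * r ^- (m0 + n0)) r); first by rewrite r0.
  move=> x j; have [hi|[c [t [Ex ht]]]] := last_corner m0 n0 x j.
    rewrite tauE no_incoming_loop_state // mulr0 normr0.
    by rewrite !mulr_ge0 ?invr_ge0 ?exprn_ge0 // ltW.
  rewrite Ex; apply: le_trans (tE _ _ _ ht) _; rewrite -mulrA ler_wpM2l //.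
  rewrite ler_pdivlMl ?exprn_gt0 // -exprD ler_wiXn2l ?ltW // addnC.
  exact: size_le.
apply: (@ell2_geometricC _ _ (B * 2 ^+ (2 * (m0 + n0))) 2^-1).
  by rewrite invr_gt0 ltr0n invf_lt1 ?ltr1n.
move=> x j; have [hi|[c [t [Ex ht]]]] := last_corner m0 n0 x j.
  rewrite tauE no_incoming_loop_state // mulr0 normr0.
  by rewrite !mulr_ge0 ?invr_ge0 ?exprn_ge0 ?invr_ge0.
have [a [s Ej]] := dirP j.
have [Es|Es] : s = coordinate a c \/ s = ~~ coordinate a c.
    by case: s (coordinate a c) {Ej} => [] []; [left | right | right | left].
  rewrite Ex tauE mxE emittedE // Ej Es hleak !mulr0 normr0.
  by rewrite !mulr_ge0 ?invr_ge0 ?exprn_ge0 ?invr_ge0.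
have tl : (t < len a)%N.
  rewrite ltnNge; apply/negP => tl; have /ht : ((len a).-1 < t)%N by rewrite prednK ?len_gt0.
  by rewrite prednK ?len_gt0 // Ej Es pos_dep pos_corner.
have hs : (size1 x <= 2 * (m0 + n0))%N.
  rewrite Ex; apply: leq_trans (size_le _ _ _) _.
  rewrite mul2n -addnn leq_add2r (leq_trans tl) //.
  by case: (a) => /=; [exact: leq_addl | exact: leq_addr].
rewrite {1}Ex; apply: le_trans (tE _ _ _ ht) _; rewrite -mulrA ler_wpM2l //.
apply: (@le_trans _ _ 1); first by rewrite exprn_ile1 // ltW.
by rewrite exprVn ler_pdivlMr ?exprn_gt0 // mul1r ler_eXn2l // ltr1n.
Qed.

End Eigenvector.

(** * Counting the eigenvalues *)

(** [X^n - P] is prime to its derivative [n X^(n-1)], so it has [n] simple roots. *)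
Lemma count_nth_roots (F : closedFieldType) (n : nat) (P : F) :
  n%:R != 0 :> F -> P != 0 ->
  exists2 s : seq F, size s = n & forall z, count_mem z s = (z ^+ n == P).
Proof.
move=> n0 P0; have n_gt0 : (0 < n)%N by case: n n0 => //; rewrite eqxx.
pose p : {poly F} := 'X^n - P%:P.
have pm : p \is monic by rewrite monicXnsubC.
have [s Es] := closed_field_poly_normal p; rewrite (monicP pm) scale1r in Es.
exists s; first by apply: eq_add_S; rewrite -(size_prod_XsubC s id) -Es size_XnsubC.
have us : uniq s.
  rewrite -separable_prod_XsubC -Es unlock /p; case: n n0 {n_gt0 p pm Es} => [|n] n0.
    by rewrite eqxx in n0.
  rewrite linearB /= derivC subr0 derivXn -scaler_nat coprimepZr // exprS.
  rewrite -polyCN coprimep_sym coprimep_addl_mul -[(- P)%:P]mulr1 mul_polyC.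
  by rewrite coprimepZr ?coprimep1 // oppr_eq0.
move=> z; rewrite count_uniq_mem // -root_prod_XsubC -Es /p rootE !hornerE.
by rewrite subr_eq0.
Qed.

Section LoopAmplitude.
Variables (R : realType).
Local Notation K := R[i].
Variables (m0 n0 : nat) (C : int * int -> 'M[K]_4) (lam : K).
Local Notation len := (len m0 n0).
Hypothesis lam0 : lam != 0.

(** The amplitude of an eigenvector after [k] corners of loop [b], starting from
    the value [1]. *)
Fixpoint transport (b : bool) (k : nat) : K :=
  if k is k'.+1 then let p := iter k' turn (base b) in
    lam ^- len (~~ p.2) * (kappa m0 n0 C p * transport b k')
  else 1.

(** Each corner on the way changes both the axis and one coordinate, so this
    parity is constant along a loop and tells which of the two loops [p] is on;
    [loop_rank] is the number of corners met since the starting point. *)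
Definition loop_label (p : bool * bool * bool) : bool :=
  p.2 (+) (p.1.1 (+) p.1.2).

Definition loop_rank (p : bool * bool * bool) : nat :=
  if p.1.1 (+) p.1.2 then (if coordinate p.2 p.1 then 1 else 3)%N
  else (if p.1.1 then 2 else 0)%N.

Definition loop_amp (b : bool) (p : bool * bool * bool) : K :=
  if loop_label p == b then transport b (loop_rank p) else 0.

Lemma transport4 b : lam ^+ (2 * (m0 + n0)) = monodromy m0 n0 C b ->
  transport b 4 = 1.
Proof.
move=> lamP.
have E : lam ^+ (2 * (m0 + n0)) =
    lam ^+ len b * (lam ^+ len (~~ b) * (lam ^+ len b * lam ^+ len (~~ b))).
  by rewrite -!exprD; congr (_ ^+ _); case: b {lamP} => /=; lia.
rewrite /= !negbK; move: lamP; rewrite E /monodromy 4!big_ord_recl big_ord0 /=.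
move: (kappa _ _ _ _) (kappa _ _ _ _) (kappa _ _ _ _) (kappa _ _ _ _) => k3 k2 k1 k0.
have := expf_neq0 (len b) lam0; have := expf_neq0 (len (~~ b)) lam0.
move: (lam ^+ _) (lam ^+ _) => x y x0 y0 h.
transitivity (k0 * (k1 * (k2 * (k3 * 1))) / (y * (x * (y * x)))).
  by field; rewrite x0 y0.
by rewrite -h divff // !mulf_neq0.
Qed.

(** Inside the loop this is the definition of [transport]; closing up after the
    fourth corner is [transport4], where [lam^L = P] is used. *)
Lemma loop_amp_turn b p : lam ^+ (2 * (m0 + n0)) = monodromy m0 n0 C b ->
  loop_amp b (turn p) = lam ^- len (~~ p.2) * (kappa m0 n0 C p * loop_amp b p).
Proof.
move=> /transport4; rewrite /loop_amp.
by case: p => [[[] []] []]; case: b => h4; rewrite /= ?mulr0 // -[LHS]h4.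
Qed.

Lemma loop_amp_base b b' : loop_amp b (base b') = (b' == b)%:R.
Proof. by rewrite /loop_amp /loop_label /loop_rank /= addbF; case: eqP. Qed.

End LoopAmplitude.

Section TwistedWalk.
Variables (R : realType).
Local Notation K := R[i].
Variables (m0 n0 : nat) (hm0 : (0 < m0)%N) (hn0 : (0 < n0)%N).
Local Notation pos := (pos m0 n0).
Local Notation corner x := (x \in corners m0 n0).
Local Notation L := (2 * (m0 + n0))%N.
Variable C : int * int -> 'M[K]_4.
Hypothesis Cuni : forall x, C x \is unitarymx.
Hypothesis C1 : forall x, ~~ corner x -> C x = 1%:M.
Hypothesis Crefl : forall c a, C (pos c) (dep c a) (arr c a) = 0.
Variable q : K.
Hypothesis q0 : q != 0.
Hypothesis mono_ge : forall b, `|q| ^+ L <= `|monodromy m0 n0 C b|.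
(** Either the eigenvalues lie outside of the circle of radius [|q|], or the
    corners do not connect the loops to the outgoing rays. *)
Hypothesis leak : (forall b, `|q| ^+ L < `|monodromy m0 n0 C b|) \/
  forall c a a', C (pos c) (arr c a) (arr c a') = 0.
Variable A : state R -> state R.
Hypothesis A_tau : forall v, A (tau q v) = tau q (walk C v).

Lemma tauVK v : tau q^-1 (tau q v) = v.
Proof. by rewrite -{2}[q]invrK tauK // invr_eq0. Qed.

Lemma iter_tau lam v n :
  iter n (fun u => A u - lam *: u) (tau q v) = tau q (iter n (resid C lam) v).
Proof. by elim: n => //= n ->; rewrite A_tau -tau_lin. Qed.

(** [lam^L = P] is what closes the loop amplitudes up, and the bounds on [|P|]
    are bounds on [|lam|^L]. *)
Lemma loop_eigenvector lam b : lam ^+ L = monodromy m0 n0 C b ->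
  exists v, [/\ no_incoming m0 n0 v, walk C v = lam *: v,
    forall b', amp m0 n0 v (base b') = (b' == b)%:R & ell2 (tau q v)].
Proof.
move=> hlam; have L0 : (0 < L)%N by lia.
have lam0 : lam != 0.
  apply/eqP => z; have := mono_ge b; rewrite -hlam z expr0n gtn_eqF // normr0.
  by rewrite (lt_geF (exprn_gt0 _ _)) // normr_gt0.
have ql : `|q| <= `|lam|.
  by rewrite -(@ler_pXn2r _ L) ?nnegrE // -[in leRHS]normrX hlam.
pose g := loop_amp m0 n0 C lam b.
have hg : forall p, g (turn p) = lam ^- len m0 n0 (~~ p.2) * (kappa m0 n0 C p * g p).
  by move=> p; apply: loop_amp_turn.
exists (loop_state m0 n0 C lam g); split.
- exact: no_incoming_loop_state.
- exact: loop_state_eigen.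
- by move=> b'; rewrite amp_loop_state // /g loop_amp_base.
apply: loop_state_ell2 => //; case: leak => [lt_q|no_leak].
  by left; rewrite -(@ltr_pXn2r _ L) ?nnegrE // -[in ltRHS]normrX hlam.
by right=> c a; rewrite /departure big1 // => a' _; rewrite no_leak mul0r.
Qed.

Lemma twisted_point_spectrum lam b : lam ^+ L = monodromy m0 n0 C b ->
  point_spectrum A lam.
Proof.
move=> /loop_eigenvector[v [_ hv hb h2]]; exists (tau q v) => //; split.
  apply/eqP => /(congr1 (tau q^-1)); rewrite tauVK => v0.
  have := hb b; rewrite v0 eqxx /amp /tau !mxE mulr0 => /esym/eqP.
  by rewrite oner_eq0.
by apply/subr0_eq; rewrite A_tau hv -tau_lin subrr tau0.
Qed.

Hypothesis q1 : `|q| <= 1.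

(** A basis is given by one circulating eigenvector for each loop whose
    monodromy is [lam^L]; the amplitudes at the two starting points are the
    coordinates. *)
Lemma twisted_has_dim lam :
  has_dim (gen_eigenspace A lam) #|[pred b | lam ^+ L == monodromy m0 n0 C b]|.
Proof.
set S := [pred b | _].
have hS (i : 'I_#|S|) : lam ^+ L = monodromy m0 n0 C (enum_val i).
  by apply/eqP; have := enum_valP i; rewrite inE.
have [w hw] := choice (fun i => loop_eigenvector (hS i)).
have ampw i k : amp m0 n0 (w i) (base (enum_val k)) = (i == k)%:R.
  by have [_ _ -> _] := hw i; rewrite (inj_eq enum_val_inj) eq_sym.
pose comb (c : 'I_#|S| -> K) : state R := \sum_i c i *: w i.
have comb_amp c p : amp m0 n0 (comb c) p = \sum_i c i * amp m0 n0 (w i) p.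
  have hD : {morph (fun u : state R => amp m0 n0 u p) : u v / u + v >-> u + v}.
    by move=> u v; apply: ampD.
  have h0 : amp m0 n0 (0 : state R) p = 0 by rewrite /amp mxE.
  rewrite /comb (big_morph _ hD h0); apply: eq_bigr => i _; exact: ampZ.
have comb_eig c : walk C (comb c) = lam *: comb c.
  apply: (big_ind (fun u => walk C u = lam *: u)) => [|u v hu hv|i _].
  - by rewrite walk0 scaler0.
  - by rewrite walkD hu hv scalerDr.
  - by have [_ hwi _ _] := hw i; rewrite walkZ hwi !scalerA mulrC.
have comb_in c : no_incoming m0 n0 (comb c).
  apply: (big_ind (no_incoming m0 n0)) => [x j _|u v hu hv x j h|i _ x j h].
  - by rewrite mxE.
  - by have := hu x j h; have := hv x j h; rewrite [RHS]/= mxE => -> ->; rewrite addr0.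
  - by have [hi _ _ _] := hw i; rewrite mxE hi // mulr0.
have tau_comb c : \sum_i c i *: tau q (w i) = tau q (comb c).
  rewrite /comb (big_morph (tau q) (tauD q) (tau0 q)).
  by apply: eq_bigr => i _; rewrite tauZ.
have amp_comb c k : amp m0 n0 (comb c) (base (enum_val k)) = c k.
  rewrite comb_amp (bigD1 k) //= big1 => [|i ik].
    by rewrite ampw eqxx mulr1 addr0.
  by rewrite ampw (negPf ik) mulr0.
exists (fun i => tau q (w i)); split.
- move=> i; have [_ hwi _ h2] := hw i; split=> //; exists 1%N.
  by rewrite iter_tau /= /resid hwi subrr tau0.
- move=> c; rewrite tau_comb => /(congr1 (tau q^-1)); rewrite tauVK => h k.
  rewrite -amp_comb h.
  by rewrite /amp !mxE mulr0.
move=> u [h2 [n]]; rewrite -[u](tauK _ q0) iter_tau; set v := tau q^-1 u.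
move=> /(congr1 (tau q^-1)); rewrite tauVK.
rewrite tau0 => hn; have hd : decays (tau q v) by rewrite tauK //; exact: ell2_decays.
exists (fun i => amp m0 n0 v (base (enum_val i))); rewrite tau_comb.
congr (tau q _); set c := fun i => _.
(* for |lam| < |q| there is no eigenvector, and all coordinates vanish *)
have [v0|[ql hin hv]] := gen_eigenP hm0 hn0 Cuni C1 Crefl q0 q1 hd hn.
  rewrite v0 /comb big1 // => i _.
  by rewrite /c v0 /amp mxE scale0r.
have lam0 : lam != 0 by rewrite -normr_gt0 (lt_le_trans _ ql) // normr_gt0.
have E p : amp m0 n0 (v - comb c) p = amp m0 n0 v p - amp m0 n0 (comb c) p.
  by rewrite -scaleN1r ampD ampZ mulN1r.
apply/subr0_eq/(eigen_eq0 hm0 hn0 C1 Crefl lam0) => [x j h||b].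
- by rewrite -scaleN1r mxE [X in _ + X]mxE hin // comb_in // mulr0 addr0.
- by rewrite -scaleN1r walkD walkZ hv comb_eig scalerDr !scalerA mulrC.
rewrite E; have [bS|bS] := boolP (b \in S).
  by rewrite -[b](enum_rankK_in bS bS) amp_comb /c subrr.
have [->|nz] := eqVneq (amp m0 n0 v (base b)) 0; last first.
  by case/negP: bS; rewrite inE (eigen_monodromy hm0 hn0 C1 Crefl hin hv nz).
rewrite comb_amp big1 ?subr0 // => i _; have [_ _ -> _] := hw i.
case: eqVneq => [Eb|_]; last by rewrite mulr0.
by rewrite Eb enum_valP in bS.
Qed.

(** The eigenvalues are listed as the [L]-th roots of both monodromies, so a
    common root of the two equations is counted twice. *)
Lemma twisted_num_eigenvalues : num_eigenvalues A (4 * (m0 + n0)).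
Proof.
have nz b : monodromy m0 n0 C b != 0.
  by rewrite -normr_gt0 (lt_le_trans _ (mono_ge b)) // exprn_gt0 // normr_gt0.
have Lnz : L%:R != 0 :> K by rewrite pnatr_eq0; lia.
have [s1 z1 h1] := count_nth_roots Lnz (nz true).
have [s2 z2 h2] := count_nth_roots Lnz (nz false).
exists (s1 ++ s2); first by rewrite size_cat z1 z2; lia.
move=> lam; rewrite count_cat h1 h2.
have -> : ((lam ^+ L == monodromy m0 n0 C true) +
    (lam ^+ L == monodromy m0 n0 C false) =
    #|[pred b | lam ^+ L == monodromy m0 n0 C b]|)%N.
  rewrite -sum1_card; under [RHS]eq_bigl do rewrite inE.
  by rewrite big_mkcond big_bool /=; do 2!case: eqP.
exact: twisted_has_dim.
Qed.

End TwistedWalk.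

(** * Complex exponentials *)

Section Exponential.
Variables (R : realType).
Local Notation K := R[i].

Lemma normr_normc (z : K) : `|z| = (Normc.normc z)%:C.
Proof. by []. Qed.

Lemma cexpD (z w : K) : cexp (z + w) = cexp z * cexp w.
Proof.
case: z w => a b [c d]; rewrite /cexp /= expRD cosD sinD.
rewrite rmorphM /= mulrACA; congr (_ * _).
by apply/eqP; rewrite eq_complex /=; apply/andP; split; apply/eqP; ring.
Qed.

Lemma cexp0 : cexp (0 : K) = 1.
Proof. by rewrite /cexp /= expR0 cos0 sin0 mul1r. Qed.

Lemma cexp_neq0 (z : K) : cexp z != 0.
Proof.
apply/eqP => h; have := cexpD z (- z); rewrite subrr cexp0 h mul0r => /eqP.
by rewrite oner_eq0.
Qed.

Lemma cexpMn (z : K) (n : nat) : cexp (n%:R * z) = cexp z ^+ n.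
Proof.
elim: n => [|n IH]; first by rewrite mul0r cexp0.
by rewrite -natr1 mulrDl mul1r cexpD IH exprSr.
Qed.

Lemma cexpMz (z : K) (n : int) : cexp (n%:~R * z) = cexp z ^ n.
Proof.
case: n => n; first by rewrite -pmulrn cexpMn.
rewrite NegzE mulrNz -pmulrn mulNr -exprnN -cexpMn.
by apply: (mulIf (cexp_neq0 (n.+1%:R * z))); rewrite -cexpD addNr cexp0 mulVf ?cexp_neq0.
Qed.

Lemma norm_cexp (z : K) : `|cexp z| = (expR (complex.Re z))%:C.
Proof.
rewrite /cexp normrM [X in _ * X]normc_def /= cos2Dsin2 sqrtr1 mulr1.
by rewrite ger0_norm // ler0c expR_ge0.
Qed.

(** The derivative of the arctangent is at most [1]. *)
Lemma atan_le (t : R) : `|atan t| <= `|t|.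
Proof.
wlog t0 : t / 0 < t.
  move=> h; have [t0|t0|->] := ltgtP t 0; last by rewrite atan0.
    by rewrite -normrN -atanN -(normrN t); apply: h; rewrite oppr_gt0.
  exact: h.
have catan : {within `[0, t], continuous (@atan R)}.
  by apply: derivable_within_continuous => z _; exact: ex_derive.
have [c _] := MVT t0 (fun x _ => is_derive1_atan x) catan.
rewrite atan0 !subr0 => E; rewrite E normrM ger0_norm; last first.
  by rewrite invr_ge0 addr_ge0 ?sqr_ge0.
rewrite ler_piMl // invf_le1 ?ltr_pwDl ?sqr_ge0 // lerDl; exact: sqr_ge0.
Qed.

(** The principal logarithm [ln |P| + i atan (b / a)] of [P = a + i b]: both
    parts are at most [2 |P - 1|], since [|P|] and [a] are at least one half. *)
Lemma log_near1 (P : K) : Normc.normc (P - 1) <= 2^-1 ->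
  exists2 w : K, cexp w = P & Normc.normc w <= 4 * Normc.normc (P - 1).
Proof.
have leRe (z : K) : `|complex.Re z| <= Normc.normc z.
  by case: z => a b; rewrite /= -sqrtr_sqr ler_sqrt ?addr_ge0 ?sqr_ge0 // lerDl sqr_ge0.
have leIm (z : K) : `|complex.Im z| <= Normc.normc z.
  by case: z => a b; rewrite /= -sqrtr_sqr ler_sqrt ?addr_ge0 ?sqr_ge0 // lerDr sqr_ge0.
have normc_le (a b : R) : Normc.normc (a +i* b) <= `|a| + `|b|.
  rewrite /= -(ger0_norm (addr_ge0 (normr_ge0 a) (normr_ge0 b))) -sqrtr_sqr.
  rewrite ler_sqrt ?sqr_ge0 // sqrrD !real_normK ?num_real //.
  by rewrite addrAC lerDl mulrn_wge0 // mulr_ge0.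
set d := Normc.normc (P - 1) => hd.
have n1 : Normc.normc (1 : K) = 1 by rewrite Normc.normc1.
have Nle : Normc.normc P <= d + 1.
  by have := le_normcD (P - 1) 1; rewrite subrK n1.
have Nge : 1 <= d + Normc.normc P.
  have := le_normcD (1 - P) P; rewrite subrK n1.
  by rewrite -[1 - P]opprB normcN.
have := leRe (P - 1); have := leIm (P - 1); rewrite -/d.
move: (normr_ge0 (complex.Re (P - 1))).
clearbody d; move: hd Nle Nge; case: P => a b; set N := Normc.normc _ => hd Nle Nge.
rewrite /= subr0 => _ hb ha.
have a0 : 0 < a by move: ha; rewrite ler_norml => /andP[]; lra.
have a2 : 2^-1 <= a by move: ha; rewrite ler_norml => /andP[]; lra.
have N0 : 0 < N by lra.
have NE : N = a * Num.sqrt (1 + (b / a) ^+ 2).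
  rewrite /N /= -[X in X * _](ger0_norm (ltW a0)) -sqrtr_sqr -sqrtrM ?sqr_ge0 //.
  by congr Num.sqrt; field; rewrite gt_eqF.
have s0 : Num.sqrt (1 + (b / a) ^+ 2) != 0.
  by apply: contraTneq N0 => z; rewrite NE z mulr0 ltxx.
have hc : N * cos (atan (b / a)) = a by rewrite cos_atan NE mulfK.
have hs : N * sin (atan (b / a)) = b.
  have : tan (atan (b / a)) = b / a by rewrite atanK.
  rewrite /tan => /(congr1 ( *%R^~ (cos (atan (b / a))))).
  rewrite divfK; last by rewrite cos_atan invr_eq0.
  by move=> ->; rewrite mulrCA hc divfK // gt_eqF.
exists (ln N +i* atan (b / a)).
  rewrite /cexp /= lnK ?posrE //; apply/eqP; rewrite eq_complex /=.
  by rewrite !mul0r subr0 addr0 hc hs !eqxx.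
apply: le_trans (normc_le _ _) _.
have h1 : `|ln N| <= 2 * d.
  rewrite ler_norml; apply/andP; split; last first.
    have := @le_ln1Dx R (N - 1); rewrite subrKC => h.
    by have := h ltac:(lra); lra.
  have := @le_ln1Dx R (N^-1 - 1); rewrite subrKC lnV ?posrE // => h.
  have Ni : 0 < N^-1 by rewrite invr_gt0.
  have := h ltac:(lra).
  have : N^-1 - 1 <= 2 * d; last by lra.
  have -> : N^-1 - 1 = (1 - N) / N by field; rewrite gt_eqF.
  rewrite ler_pdivrMr //; nra.
have h2 : `|atan (b / a)| <= 2 * d.
  apply: le_trans (atan_le _) _; rewrite normrM normfV (gtr0_norm a0).
  rewrite ler_pdivrMr //; nra.
lra.
Qed.

End Exponential.

(** * The model *)

Section Model.
Variables (R : realType).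
Local Notation K := R[i].

Lemma mx_entry_le (M : 'M[K]_4) i j : `|M i j| <= `|M|.
Proof.
rewrite [leRHS]/Num.Def.normr /= mx_normE -[leLHS]nngE num_le.
exact: (le_bigmax _ (fun ij => `|M ij.1 ij.2|%:nng) (i, j)).
Qed.

Variables (m0 n0 : nat) (hm0 : (0 < m0)%N) (hn0 : (0 < n0)%N).
Local Notation pos := (pos m0 n0).
Local Notation corner x := (x \in corners m0 n0).

(** The elastic coins are permutations of the directions: what arrives from
    inside changes axis and stays inside, what arrives from outside is sent back
    along its own axis. *)
Definition el_perm (c : bool * bool) (j : 'I_4) : 'I_4 :=
  let f a s := if s == coordinate a c then dep c (~~ a) else arr c a in
  nth chL [:: f false false; f false true; f true false; f true true] j.

Lemma el_perm_dir c a s :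
  el_perm c (dir a s) = if s == coordinate a c then dep c (~~ a) else arr c a.
Proof. by case: a s => [] []. Qed.

Lemma C_el_pos c i j : C_el R m0 n0 (pos c) i j = (i == el_perm c j)%:R.
Proof.
have m1 : (m0%:Z == 0) = false by lia.
have n1 : (n0%:Z == 0) = false by lia.
have hj := ltn_ord j.
rewrite /C_el /pos.
case: c => [[] []] /=; rewrite ?xpair_eqE ?m1 ?n1 ?eqxx ?(eq_sym 0) ?m1 ?n1 /= mxE;
 congr (_ == _)%:R; case: j hj => [[|[|[|[|//]]]] hj'] _ //=.
Qed.

Lemma el_perm_inj c : injective (el_perm c).
Proof.
move=> j k; case: (dirP j) => a [s ->]; case: (dirP k) => b [t ->].
rewrite !el_perm_dir; case: c => [[] []]; case: a s b t => [] [] [] [] //=.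
Qed.

Lemma C_el_free x : ~~ corner x -> C_el R m0 n0 x = 1%:M.
Proof.
rewrite /corners !inE !negb_or /C_el => /and4P[h1 h2 h3 h4].
by rewrite (negPf h1) (negPf h2) (negPf h3) (negPf h4).
Qed.

Lemma C_el_unitary x : C_el R m0 n0 x \is unitarymx.
Proof.
have [/cornersP[c ->]|h] := boolP (corner x); last first.
  by rewrite C_el_free //; apply/unitarymxP; rewrite trmx1 map_mx1 mulmx1.
apply/unitarymxP/matrixP => i k; rewrite !mxE.
have := injF_bij (@el_perm_inj c) => -[h hK Kh].
rewrite (bigD1 (h i)) //= big1 => [|j ji].
  by rewrite !mxE !C_el_pos Kh eqxx mul1r conjC_nat addr0 eq_sym.
rewrite !mxE C_el_pos; case: eqP => [E|]; last by rewrite mul0r.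
by move: ji; rewrite E hK eqxx.
Qed.

Lemma C_el_arr c i a : C_el R m0 n0 (pos c) i (arr c a) = (i == dep c (~~ a))%:R.
Proof. by rewrite C_el_pos el_perm_dir eqxx. Qed.

Lemma C_el_refl c a : C_el R m0 n0 (pos c) (dep c a) (arr c a) = 0.
Proof.
rewrite C_el_arr; case: eqP => // /dir_inj[E].
by case: a E.
Qed.

Lemma C_el_noleak c a a' : C_el R m0 n0 (pos c) (arr c a) (arr c a') = 0.
Proof.
rewrite C_el_arr; case: eqP => // /dir_inj[-> ].
by case: (coordinate (~~ a') c).
Qed.

Lemma C_el_kappa p : kappa m0 n0 (C_el R m0 n0) p = 1.
Proof. by rewrite /kappa C_el_arr eqxx. Qed.

Lemma C_el_monodromy b : monodromy m0 n0 (C_el R m0 n0) b = 1.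
Proof. by rewrite /monodromy big1 // => k _; exact: C_el_kappa. Qed.

(** For [|x| <= 1] one has [|x y - 1| <= |x - 1| + |y - 1|], because
    [x y - 1 = (x - 1) + x (y - 1)]; unitarity bounds the coefficients by [1], so
    the four errors simply add up. *)
Lemma near_monodromy (C : int * int -> 'M[K]_4) (e : K) b :
  (forall x, C x \is unitarymx) ->
  (forall x, corner x -> `|C x - C_el R m0 n0 x| <= e) ->
  `|monodromy m0 n0 C b - 1| <= 4 * e.
Proof.
move=> hu hC.
have hk p : `|kappa m0 n0 C p| <= 1 /\ `|kappa m0 n0 C p - 1| <= e.
  split; first exact: unitary_entry.
  apply: le_trans (hC _ (pos_corner m0 n0 p.1)).
  rewrite -(C_el_kappa p); apply: le_trans (mx_entry_le _ (dep p.1 (~~ p.2)) (arr p.1 p.2)).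
  by rewrite !mxE.
have hstep (x y : K) (s t : K) : `|x| <= 1 -> `|x - 1| <= s -> `|y - 1| <= t ->
    `|x * y - 1| <= s + t.
  move=> x1 hx hy; have -> : x * y - 1 = (x - 1) + x * (y - 1) by ring.
  apply: le_trans (ler_normD _ _) _; rewrite lerD // normrM.
  by apply: le_trans hy; rewrite ler_piMl.
rewrite /monodromy 4!big_ord_recl big_ord0.
have -> : 4 * e = e + (e + (e + (e + 0))) by ring.
do 4!apply: (hstep _ _ _ _ (hk _).1 (hk _).2).
by rewrite subrr normr0.
Qed.

End Model.

(** * Complex translation of a walk *)

Section Torus.
Variables (R : realType).
Local Notation K := R[i].

Lemma torus_expE n (theta : torusC R) :
  torus_exp n theta = torus_exp (-1) theta ^ (- n).
Proof.
have E m : torus_exp m theta = cexp ('i * repr theta) ^ m.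
  by rewrite -cexpMz /torus_exp; congr cexp; rewrite mulrAC mulrC.
by rewrite !E exprz_exp mulN1r opprK.
Qed.

Lemma torus_exp_neq0 n (theta : torusC R) : torus_exp n theta != 0.
Proof. exact: cexp_neq0. Qed.

Lemma norm_torus_exp (theta : torusC R) :
  `|torus_exp (-1) theta| = (expR (torus_Im theta))%:C.
Proof.
rewrite norm_cexp /torus_Im; case: (repr theta) => a b /=.
by congr (expR _)%:C; ring.
Qed.

Lemma ctransE (theta : torusC R) v :
  ctrans theta v = tau (torus_exp (-1) theta) v.
Proof.
apply: state_ext => x j; rewrite tauE.
rewrite /ctrans /ctrans_mx mul_diag_mx !mxE; congr (_ * _).
by case: (dirP j) => a [s ->]; rewrite /dir /expo /dirv; case: a s => [] [] /=;
  rewrite torus_expE; congr (_ ^ _); lia.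
Qed.

Lemma ctransK (theta : torusC R) v : ctrans_inv theta (ctrans theta v) = v.
Proof.
apply/funext => x; rewrite /ctrans_inv /ctrans mulKmx // unitmxE det_diag unitfE.
apply/prodf_neq0 => j _; rewrite mxE; case: j => [[|[|[|[|//]]]] h] /=;
  exact: torus_exp_neq0.
Qed.

Lemma shift_walk (v : state R) : qw_shift v = walk (fun=> 1%:M) v.
Proof. by rewrite /walk; congr qw_shift; apply/funext => x; rewrite mul1mx. Qed.

(** [T S T^-1 = q S], so the two terms defining [U(theta)] recombine into
    [T U T^-1], as an identity on all sequences. *)
Lemma walk_theta_tau C (theta : torusC R) v :
  walk_theta C theta (tau (torus_exp (-1) theta) v) =
  tau (torus_exp (-1) theta) (walk C v).
Proof.
have q0 := torus_exp_neq0 (-1) theta.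
rewrite /walk_theta -ctransE ctransK !ctransE; set q := torus_exp _ _ in q0 *.
have -> : q *: qw_shift (tau q v) = tau q (qw_shift v).
  rewrite !shift_walk; apply: state_ext => x j.
  rewrite mxE tauE -[x](subrK (dirv j)) !walk_coin1 //.
  rewrite tauE -[dirv j in RHS]mulr1n expoD [q ^ (_ + _)]expfzDr // -exprnP expr1.
  by rewrite mulrA; congr (_ * _); rewrite mulrC.
by rewrite -tauD addrC subrK.
Qed.

End Torus.

(** * Eigenvalues close to the elastic ones *)

Lemma torus_norm_pi (R : realType) (z : R[i]) :
  torus_norm (\pi_(torusC R) z) <= Normc.normc z.
Proof.
apply: ge_inf; last by exists z.
by exists 0 => _ [w _ <-]; exact: normc_nneg.
Qed.

(** With [w] a small logarithm of [P], the point [2 pi k / L + i w / L] works: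
    [-i L] times it is [w - 2 pi i k]. *)
Lemma root_near (R : realType) (m0 n0 k : nat) (P : R[i]) : (0 < m0)%N ->
  Normc.normc (P - 1) <= 2^-1 ->
  exists kp : torusC R,
    torus_exp (-1) kp ^+ (2 * (m0 + n0)) = P /\
    torus_norm (kp - \pi_(torusC R) (pi * k%:R / (m0 + n0)%:R)%:C)
      <= 4 * Normc.normc (P - 1).
Proof.
move=> hm0 /log_near1[w Ew hw]; set x := pi * _ / _; set L := (2 * (m0 + n0))%N.
have L0 : L%:R != 0 :> R[i] by rewrite pnatr_eq0 /L; lia.
exists (\pi_(torusC R) (x%:C + 'i * w / L%:R)); split.
  rewrite torus_exp_pi -cexpMn -Ew -[RHS](@cexp_twopi R _ (- k%:Z)).
  congr cexp.
  have Ex : L%:R * x%:C = (2 * pi * k%:R)%:C :> R[i].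
    rewrite -[L%:R](rmorph_nat (real_complex R)) -rmorphM /=; congr (_%:C).
    by rewrite /x /L natrM; field; rewrite -natrD pnatr_eq0; lia.
  have -> : (2 * pi * (- k%:Z)%:~R)%:C = - (L%:R * x%:C) :> R[i].
    by rewrite Ex mulrNz -pmulrn mulrN rmorphN.
  rewrite mulrN1z.
  have i2 : ('i : R[i]) * 'i = -1 by rewrite -expr2 sqr_i.
  transitivity (- ('i * 'i) * w + 'i * - (L%:R * x%:C)); last first.
    by rewrite i2 opprK mul1r.
  by field.
have piB (a b : R[i]) :
    \pi_(torusC R) a - \pi_(torusC R) b = \pi_(torusC R) (a - b).
  by rewrite !piE.
rewrite piB addrAC subrr add0r.
apply: le_trans (torus_norm_pi _) _; apply: le_trans hw.
rewrite !Normc.normcM Normc.normcV.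
have -> : Normc.normc ('i : R[i]) = 1 by rewrite /= expr0n add0r expr1n sqrtr1.
have -> : Normc.normc (L%:R : R[i]) = L%:R.
  by apply: complexI; rewrite -normr_normc normr_nat rmorph_nat.
rewrite mul1r ler_piMr ?normc_nneg // invf_le1 ?ler1n ?ltr0n /L; lia.
Qed.

Theorem proposition4p3 (R : realType) (m0 n0 : nat)
    (hm0 : (0 < m0)%N) (hn0 : (0 < n0)%N)
    (C : R -> int * int -> 'M[R[i]]_4)
    (hunitary : forall eps : R, 0 < eps <= 1 ->
       forall x, C eps x \is unitarymx)
    (hi : forall eps : R, 0 < eps <= 1 ->
       forall x, x \notin corners m0 n0 -> C eps x = 1%:M)
    (hii : forall eps : R, 0 < eps <= 1 ->
       forall x, x \in corners m0 n0 -> `|C eps x - C_el R m0 n0 x| < eps%:C)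
    (hiii : forall eps : R, 0 < eps <= 1 ->
       [/\ C eps (0, 0) chR chL = 0 /\ C eps (0, 0) chU chD = 0,
           C eps (m0%:Z, 0) chU chD = 0 /\ C eps (m0%:Z, 0) chL chR = 0,
           C eps (m0%:Z, n0%:Z) chD chU = 0 /\ C eps (m0%:Z, n0%:Z) chL chR = 0
         & C eps (0, n0%:Z) chR chL = 0 /\ C eps (0, n0%:Z) chD chU = 0])
    (theta : torusC R) (htheta : torus_Im theta < 0) :
  exists eps0 : R,
    [/\ 0 < eps0 <= 1,
        forall eps : R, 0 < eps <= eps0 ->
          num_eigenvalues (walk_theta (C eps) theta) (4 * (m0 + n0))%N,
        num_eigenvalues (walk (C_el R m0 n0)) (4 * (m0 + n0))%N
      & exists2 r : R, 0 < r &
          forall k : nat, (k < 2 * (m0 + n0))%N ->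
          forall eps : R, 0 < eps <= eps0 ->
          exists kp km : torusC R,
            (point_spectrum (walk_theta (C eps) theta) (torus_exp (-1) kp) /\
             torus_norm (kp - \pi_(torusC R) (pi * k%:R / (m0 + n0)%:R)%:C)
               < r * eps) /\
            (point_spectrum (walk_theta (C eps) theta) (torus_exp (-1) km) /\
             torus_norm (km - \pi_(torusC R) (pi * k%:R / (m0 + n0)%:R)%:C)
               < r * eps)].
Proof.
set L := (2 * (m0 + n0))%N; have L0 : (L != 0)%N by rewrite /L; lia.
pose rho : R := expR (torus_Im theta).
have rho0 : 0 < rho by apply: expR_gt0.
have rho1 : rho < 1 by rewrite /rho -expR0 ltr_expR.
have rhoL : rho ^+ L < 1 by rewrite exprn_ilt1 // ltW.
have rhoL0 : 0 < rho ^+ L by rewrite exprn_gt0.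
set q := torus_exp (-1) theta; have q0 : q != 0 by apply: torus_exp_neq0.
have Eq : `|q| = rho%:C by apply: norm_torus_exp.
(* |P - 1| <= 4 eps must be at most 1/2 for the logarithm of P, and less than
   1 - rho^L for the square-summability of the rays *)
pose eps0 := (1 - rho ^+ L) / 8.
have eps0_le1 eps : 0 < eps <= eps0 -> 0 < eps <= 1.
  by rewrite /eps0 => /andP[e0 e1]; apply/andP; split; lra.
have Crefl eps : 0 < eps <= 1 ->
    forall c a, C eps (pos m0 n0 c) (dep c a) (arr c a) = 0.
  by move=> /hiii[[? ?] [? ?] [? ?] [? ?]] [[] []] [].
have near eps b : 0 < eps <= eps0 ->
    Normc.normc (monodromy m0 n0 (C eps) b - 1) <= 4 * eps.
  move=> /eps0_le1 he; rewrite -lecR -normr_normc.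
  have -> : (4 * eps)%:C = 4 * eps%:C by rewrite rmorphM rmorph_nat.
  apply: near_monodromy => // [|x hx]; first exact: hunitary.
  exact/ltW/hii.
have leak eps b : 0 < eps <= eps0 -> `|q| ^+ L < `|monodromy m0 n0 (C eps) b|.
  move=> he; rewrite Eq -rmorphXn normr_normc ltcR.
  have := near eps b he; set P := monodromy _ _ _ _ => hP.
  have := le_normcD (1 - P) P; rewrite subrK -(opprB P) normcN Normc.normc1.
  by move: he; rewrite /eps0 => /andP[]; lra.
exists eps0; split.
- by rewrite /eps0; apply/andP; split; lra.
- move=> eps he; have he1 := eps0_le1 _ he.
  apply: (@twisted_num_eigenvalues R m0 n0 hm0 hn0 (C eps) (hunitary _ he1)
    (hi _ he1) (Crefl _ he1) q q0).
  + by move=> b; apply/ltW/leak.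
  + by left=> b; apply: leak.
  + by move=> v; apply: walk_theta_tau.
  + by rewrite Eq -[1]/(1%:C) lecR ltW.
- have t1 (v : state R) : tau 1 v = v.
    apply: state_ext => x j; rewrite tauE.
    by rewrite exp1rz mul1r.
  have h1 : (1 : R[i]) != 0 by exact: oner_neq0.
  apply: (@twisted_num_eigenvalues R m0 n0 hm0 hn0 (C_el R m0 n0)
    (@C_el_unitary R m0 n0 hm0 hn0)
    (@C_el_free R m0 n0) (C_el_refl R hm0 hn0) 1 h1).
  + by move=> b; rewrite C_el_monodromy // normr1 expr1n.
  + by right=> c a a'; apply: C_el_noleak.
  + by move=> v; rewrite !t1.
  + by rewrite normr1.
(* 17 > 4 * 4, and the strict inequality is required *)
exists 17 => // k _ eps he; have he1 := eps0_le1 _ he.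
have spec (b : bool) : exists kp : torusC R,
    point_spectrum (walk_theta (C eps) theta) (torus_exp (-1) kp) /\
    torus_norm (kp - \pi_(torusC R) (pi * k%:R / (m0 + n0)%:R)%:C) < 17 * eps.
  have hb := near eps b he.
  have e12 : 4 * eps <= 2^-1 by move: he; rewrite /eps0 => /andP[]; lra.
  have [kp [E hk]] := root_near n0 k hm0 (le_trans hb e12).
  exists kp; split; last by move: he1 => /andP[]; lra.
  apply: (@twisted_point_spectrum R m0 n0 hm0 hn0 (C eps)
    (hi _ he1) (Crefl _ he1) q q0) E.
  + by move=> b'; apply/ltW/leak.
  + by left=> b'; apply: leak.
  + by move=> v; apply: walk_theta_tau.
by have [kp hp] := spec false; have [km hm] := spec true; exists kp, km.
Qed.
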